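(* Let $(X,d^X)$ be a graph with bounded geometry which is roughly isometric to a Cayley graph $(G,S,d^S)$ of a group $G$ of polynomial volume growth with homogeneous dimension $D$. Then there is a constant $C$ (independent of $d$) such that for every $d\geq1$, $$\dim H^d(X)\leq C\,d^{D-1}.$$
   Context: Graphs are connected, locally finite, without self-loops or multiple edges; $d^X$ is the graph (path-length) metric. $X$ has bounded geometry if $\deg x\leq\Delta$ for all vertices $x$ and some $\Delta>0$. For a group $G$ with finite symmetric generating set $S$, the Cayley graph has $x\sim y$ iff $x=ys$ for some $s\in S$, with word metric $d^S$. $G$ has polynomial volume growth if $|\{x: d^S(e,x)\le n\}|\leq Cn^A$ for some $C,A>0$ and all $n\ge1$; then there are an integer $D$ (homogeneous dimension) and $C_1,C_2>0$ with $C_1n^D\leq |\{x: d^S(e,x)\le n\}|\leq C_2n^D$ for all $n\geq1$. A map $\phi:X\to Y$ between metric spaces is an $(a,b)$-rough isometry ($a\geq1,b\geq0$) if $a^{-1}d^X(x,y)-b\leq d^Y(\phi(x),\phi(y))\leq a\,d^X(x,y)+b$ for all $x,y$ and every $z\in Y$ has distance at most $b$ from $\phi(X)$; $X$ and $Y$ are roughly isometric if such a map exists. The Laplacian on $X$ is $L^Xu(x)=\sum_{y\sim x}(u(y)-u(x))$. For fixed $p\in X$, $H^d(X)=\{u:X\to\mathbb{R}\mid L^Xu=0,\ |u(x)|\leq C(d^X(x,p)+1)^d\text{ for some }C\}$.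
   Formalization: For D = 0 (G finite) the bound C d^{D-1} = C d^{-1} is false, since constants are harmonic and dim H^d(X) = 1 for all d; there the proved bound is dim H^d(X) ≤ C. For D ≥ 1 the bound is as stated. *)

(* Defs.v *)
From Stdlib Require Import Reals Lra Lia List ClassicalEpsilon.
Import ListNotations.
Open Scope R_scope.

(* A locally finite graph on a vertex type V is given by its neighbour lists. *)
Definition is_graph {V : Type} (nb : V -> list V) : Prop :=
  (forall x, NoDup (nb x)) /\
  (forall x y, In y (nb x) -> In x (nb y)) /\
  (forall x, ~ In x (nb x)).

Inductive walk {V : Type} (nb : V -> list V) : V -> V -> nat -> Prop :=
| walk0 x : walk nb x x 0
| walkS x y z n : In y (nb x) -> walk nb y z n -> walk nb x z (S n).

Definition connected {V : Type} (nb : V -> list V) : Prop :=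
  forall x y, exists n, walk nb x y n.

Definition is_dist {V : Type} (nb : V -> list V) (x y : V) (n : nat) : Prop :=
  walk nb x y n /\ forall m, walk nb x y m -> (n <= m)%nat.

(* graph (path-length) metric; meaningful for connected graphs *)
Definition gdist {V : Type} (nb : V -> list V) (x y : V) : nat :=
  epsilon (inhabits 0%nat) (fun n => is_dist nb x y n).

Definition bounded_geometry {V : Type} (nb : V -> list V) : Prop :=
  exists Delta : nat, forall x, (length (nb x) <= Delta)%nat.

Definition rough_isometry {V W : Type} (nbX : V -> list V) (nbY : W -> list W)
  (phi : V -> W) (a b : R) : Prop :=
  1 <= a /\ 0 <= b /\
  (forall x y,
     / a * INR (gdist nbX x y) - b <= INR (gdist nbY (phi x) (phi y)) /\
     INR (gdist nbY (phi x) (phi y)) <= a * INR (gdist nbX x y) + b) /\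
  (forall z, exists x, INR (gdist nbY z (phi x)) <= b).

Definition roughly_isometric {V W : Type} (nbX : V -> list V) (nbY : W -> list W) : Prop :=
  exists phi a b, rough_isometry nbX nbY phi a b.

Definition is_group {G : Type} (mul : G -> G -> G) (inv : G -> G) (e : G) : Prop :=
  (forall x y z, mul x (mul y z) = mul (mul x y) z) /\
  (forall x, mul e x = x) /\ (forall x, mul x e = x) /\
  (forall x, mul (inv x) x = e) /\ (forall x, mul x (inv x) = e).

(* S (a list without repetitions) is a finite symmetric generating set;
   e is excluded so that the Cayley graph has no self-loops *)
Definition fin_sym_gen_set {G : Type} (mul : G -> G -> G) (inv : G -> G) (e : G)
  (S : list G) : Prop :=
  NoDup S /\ ~ In e S /\ (forall s, In s S -> In (inv s) S) /\
  (forall g, exists l, Forall (fun s => In s S) l /\ g = fold_right mul e l).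

(* Cayley graph: x ~ y iff x = y s for some s in S, i.e. y = x s^{-1};
   by symmetry of S the neighbours of x are the x s, s in S. *)
Definition cayley_nb {G : Type} (mul : G -> G -> G) (S : list G) (x : G) : list G :=
  map (fun s => mul x s) S.

Definition ball_card {V : Type} (nb : V -> list V) (p : V) (n k : nat) : Prop :=
  exists l : list V, NoDup l /\ length l = k /\
    (forall x, In x l <-> (gdist nb p x <= n)%nat).

Definition homogeneous_dim {G : Type} (mul : G -> G -> G) (e : G) (S : list G)
  (D : nat) : Prop :=
  exists C1 C2 : R, 0 < C1 /\ 0 < C2 /\
    forall n k : nat, (1 <= n)%nat -> ball_card (cayley_nb mul S) e n k ->
      C1 * INR n ^ D <= INR k <= C2 * INR n ^ D.

Definition laplacian {V : Type} (nb : V -> list V) (u : V -> R) (x : V) : R :=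
  fold_right (fun y acc => (u y - u x) + acc) 0 (nb x).

Definition Hd {V : Type} (nb : V -> list V) (p : V) (d : R) (u : V -> R) : Prop :=
  (forall x, laplacian nb u x = 0) /\
  exists C : R, forall x, Rabs (u x) <= C * Rpower (INR (gdist nb x p) + 1) d.

Fixpoint fsum (n : nat) (g : nat -> R) : R :=
  match n with O => 0 | S k => fsum k g + g k end.

Definition lin_indep {V : Type} (n : nat) (f : nat -> V -> R) : Prop :=
  forall c : nat -> R, (forall x, fsum n (fun i => c i * f i x) = 0) ->
    forall i, (i < n)%nat -> c i = 0.

Definition dim_le {V : Type} (H : (V -> R) -> Prop) (r : R) : Prop :=
  forall (n : nat) (f : nat -> V -> R),
    (forall i, (i < n)%nat -> H (f i)) -> lin_indep n f -> INR n <= r.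

(* Main.v *)
(*
  For linearly independent u_0, ..., u_(k-1) of growth d, the logarithm F(n) of their Gram
  determinant in l^2(B(p,n)) is at most k (2d + D) ln n + O(1), so for infinitely many h it
  grows by at most k (2d + D + 1) ln 2 between the radii m h and 2 m h, where m is about
  2d + D + 1.  Cut this range into m shells of width h.  After orthogonalising on the larger
  of two consecutive balls B(R), B(R + h), the step of F is bounded below by means of
  T = sum_l |u_l|^2_R / |u_l|^2_(R+h), so a small sum of the T's bounds k.

  To bound T, compare u(x) with an average of u over about (s(x)/T0)^D points at distance
  O(s(x)/T0) from x, where s is the distance to the outer sphere and T0 a large constant.
  The points are psi(phi(x) h), with phi : X -> G the rough isometry, psi a rough inverse
  and h in a ball of G.  By a Poincare inequality along geodesics of G and by Caccioppoli's
  inequality with cut-off s, the error is a small multiple of |u|^2_(R+h); by Bessel's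
  inequality the averages contribute O(sum_(x in B(R)) s(x)^(-D)).  Summed over the m
  shells this is O(m^D) when D >= 2, hence k = O(m^(D-1)).

  When D <= 1, infinitely many spheres have a bounded number of points, and a harmonic
  function vanishing at p and on a sphere around p vanishes inside.
*)
Require Import Defs.
From Stdlib Require Import Reals List.
From Stdlib Require Import ZArith Lra Lia ClassicalEpsilon Permutation.
Import ListNotations.
Open Scope R_scope.

(** * Finite sums over lists and indicator functions *)

Definition lsum {A : Type} (l : list A) (f : A -> R) : R :=
  fold_right (fun x acc => f x + acc) 0 l.

(** Classical truth value, so that lists over any type can be filtered by any proposition. *)
Definition decb (P : Prop) : bool :=
  if excluded_middle_informative P then true else false.

Lemma decbP (P : Prop) : decb P = true <-> P.
Proof. unfold decb; destruct (excluded_middle_informative P); split; easy. Qed.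

Definition indic (P : Prop) : R := if decb P then 1 else 0.

Lemma indic1 (P : Prop) : P -> indic P = 1.
Proof. intro H; unfold indic; now rewrite (proj2 (decbP P) H). Qed.

Lemma indic0 (P : Prop) : ~ P -> indic P = 0.
Proof.
  intro H; unfold indic; destruct (decb P) eqn:E; trivial.
  exfalso; apply H; now apply decbP.
Qed.

Lemma indic_cases (P : Prop) : (P /\ indic P = 1) \/ (~ P /\ indic P = 0).
Proof. destruct (classic P); [left | right]; split; auto using indic1, indic0. Qed.

Lemma indic_nonneg (P : Prop) : 0 <= indic P.
Proof. destruct (indic_cases P) as [[_ ->] | [_ ->]]; lra. Qed.

Section ListSums.
Context {A : Type}.
Implicit Types (l : list A) (f g : A -> R).

Lemma lsum_cons x l f : lsum (x :: l) f = f x + lsum l f.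
Proof. reflexivity. Qed.

Lemma lsum_ext l f g : (forall x, In x l -> f x = g x) -> lsum l f = lsum l g.
Proof.
  induction l as [|a l IH]; intro H; [reflexivity|].
  rewrite !lsum_cons, IH, H; simpl; auto. intros x Hx; apply H; now right.
Qed.

Lemma lsum_le l f g : (forall x, In x l -> f x <= g x) -> lsum l f <= lsum l g.
Proof.
  induction l as [|a l IH]; intro H; [apply Rle_refl|].
  rewrite !lsum_cons; apply Rplus_le_compat.
  - apply H; now left.
  - apply IH; intros x Hx; apply H; now right.
Qed.

Lemma lsum_0 l : lsum l (fun _ => 0) = 0.
Proof. induction l; [easy|]; rewrite lsum_cons, IHl; ring. Qed.

Lemma lsum_zero l f : (forall x, In x l -> f x = 0) -> lsum l f = 0.
Proof. intro H; rewrite (lsum_ext l f _ H); apply lsum_0. Qed.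

Lemma lsum_nonneg l f : (forall x, In x l -> 0 <= f x) -> 0 <= lsum l f.
Proof. intro H; rewrite <- (lsum_0 l); now apply lsum_le. Qed.

Lemma lsum_plus l f g : lsum l (fun x => f x + g x) = lsum l f + lsum l g.
Proof. induction l; [simpl; ring|]; rewrite !lsum_cons, IHl; ring. Qed.

Lemma lsum_scal l f c : lsum l (fun x => c * f x) = c * lsum l f.
Proof. induction l; [simpl; ring|]; rewrite !lsum_cons, IHl; ring. Qed.

Lemma lsum_scal_r l f c : lsum l (fun x => f x * c) = lsum l f * c.
Proof. induction l; [simpl; ring|]; rewrite !lsum_cons, IHl; ring. Qed.

Lemma lsum_minus l f g : lsum l (fun x => f x - g x) = lsum l f - lsum l g.
Proof. induction l; [simpl; ring|]; rewrite !lsum_cons, IHl; ring. Qed.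

Lemma lsum_const l c : lsum l (fun _ => c) = INR (length l) * c.
Proof.
  induction l; [simpl; ring|].
  rewrite lsum_cons, IHl; simpl length; rewrite S_INR; ring.
Qed.

Lemma lsum_app l l' f : lsum (l ++ l') f = lsum l f + lsum l' f.
Proof. induction l; simpl app; [simpl; ring|]; rewrite !lsum_cons, IHl; ring. Qed.

Lemma lsum_single_le l f x :
  (forall y, In y l -> 0 <= f y) -> In x l -> f x <= lsum l f.
Proof.
  induction l as [|a l IH]; intros H Hx; [easy|].
  rewrite lsum_cons. destruct Hx as [-> | Hx].
  - assert (0 <= lsum l f) by (apply lsum_nonneg; intros; apply H; now right). lra.
  - assert (0 <= f a) by (apply H; now left).
    assert (f x <= lsum l f) by (apply IH; trivial; intros; apply H; now right). lra.
Qed.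

Lemma lsum_eq0 l f :
  (forall x, In x l -> 0 <= f x) -> lsum l f = 0 -> forall x, In x l -> f x = 0.
Proof.
  intros H E x Hx. pose proof (lsum_single_le l f x H Hx). specialize (H x Hx). lra.
Qed.

Lemma lsum_filter l f (P : A -> Prop) :
  lsum (filter (fun x => decb (P x)) l) f = lsum l (fun x => indic (P x) * f x).
Proof.
  induction l as [|a l IH]; [easy|]. simpl filter. rewrite lsum_cons.
  destruct (indic_cases (P a)) as [[h E] | [h E]]; rewrite E.
  - rewrite (proj2 (decbP _) h), lsum_cons, IH; ring.
  - destruct (decb (P a)) eqn:D; [exfalso; apply h; apply decbP; exact D|]. rewrite IH; ring.
Qed.

(** The quadratic form [(s, t) |-> sum (s f + t g)^2] is nonnegative; suitable values of [s] and [t]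
    give the discriminant inequality. *)
Lemma lsum_cauchy l f g :
  lsum l (fun x => f x * g x) ^ 2
    <= lsum l (fun x => f x ^ 2) * lsum l (fun x => g x ^ 2).
Proof.
  set (a := lsum l (fun x => f x ^ 2)). set (b := lsum l (fun x => f x * g x)).
  set (c := lsum l (fun x => g x ^ 2)).
  assert (Hc : 0 <= c) by (apply lsum_nonneg; intros; apply pow2_ge_0).
  assert (Ha : 0 <= a) by (apply lsum_nonneg; intros; apply pow2_ge_0).
  assert (Q : forall s t, 0 <= s ^ 2 * a + 2 * (s * t) * b + t ^ 2 * c).
  { intros s t. unfold a, b, c.
    rewrite <- !lsum_scal, <- !lsum_plus. apply lsum_nonneg; intros x _.
    replace (s ^ 2 * f x ^ 2 + 2 * (s * t) * (f x * g x) + t ^ 2 * g x ^ 2)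
      with ((s * f x + t * g x) ^ 2) by ring. apply pow2_ge_0. }
  destruct (Req_dec c 0) as [E | E].
  (* When [c = 0], these values turn the form into [- b ^ 2]. *)
  - pose proof (Q b (- (a + 1) / 2)). rewrite E in *.
    assert (b ^ 2 * (a + 1) <= b ^ 2 * a) by nra. nra.
  (* Here the form equals [c (a c - b^2)]. *)
  - pose proof (Q c (- b)). assert (0 < c) by lra.
    assert (0 <= c * (c * a - b ^ 2)) by nra.
    assert (0 <= c * a - b ^ 2).
    { apply Rmult_le_reg_l with c; lra. } lra.
Qed.

Lemma lsum_sqr_le l f : lsum l f ^ 2 <= INR (length l) * lsum l (fun x => f x ^ 2).
Proof.
  pose proof (lsum_cauchy l (fun _ => 1) f) as H. cbv beta in H.
  rewrite (lsum_ext l (fun x => 1 * f x) f) in H by (intros; ring).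
  rewrite lsum_const in H. replace (1 ^ 2) with 1 in H by ring.
  now rewrite Rmult_1_r in H.
Qed.

End ListSums.

Lemma lsum_swap {A B : Type} (l : list A) (l' : list B) (f : A -> B -> R) :
  lsum l (fun x => lsum l' (fun y => f x y)) = lsum l' (fun y => lsum l (fun x => f x y)).
Proof.
  induction l as [|a l IH].
  - simpl. now rewrite lsum_0.
  - rewrite lsum_cons, IH, <- lsum_plus. now apply lsum_ext.
Qed.

Lemma In_filter_decb {A : Type} (P : A -> Prop) (l : list A) x :
  In x (filter (fun x => decb (P x)) l) <-> In x l /\ P x.
Proof. now rewrite filter_In, decbP. Qed.

(** Change of variables along a map with fibres of at most [K] elements, by splitting off the fibre
    over the head of [L]. It replaces the invariance of counting measure under exact
    translations. *)
Lemma lsum_fibre {A B : Type} (l : list A) (L : list B) (t : A -> B) (F : B -> R) (K : nat) :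
  (forall y l', NoDup l' -> incl l' l -> (forall x, In x l' -> t x = y) ->
     (length l' <= K)%nat) ->
  NoDup l -> (forall x, In x l -> In (t x) L) -> (forall y, In y L -> 0 <= F y) ->
  lsum l (fun x => F (t x)) <= INR K * lsum L F.
Proof.
  revert l; induction L as [|b L IH]; intros l HK Hl Hin HF.
  - destruct l as [|a l]; [simpl; lra|]. exfalso; apply (Hin a); now left.
  - rewrite lsum_cons.
    assert (E : lsum l (fun x => F (t x)) =
      lsum (filter (fun x => decb (t x = b)) l) (fun x => F (t x)) +
      lsum (filter (fun x => decb (t x <> b)) l) (fun x => F (t x))).
    { rewrite !lsum_filter, <- lsum_plus. apply lsum_ext; intros x _.
      destruct (indic_cases (t x = b)) as [[h ->] | [h ->]].
      - rewrite indic0 by tauto; ring.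
      - rewrite indic1 by tauto; ring. }
    rewrite E, Rmult_plus_distr_l. apply Rplus_le_compat.
    + rewrite (lsum_ext _ _ (fun _ => F b)).
      2:{ intros x Hx; apply In_filter_decb in Hx; now rewrite (proj2 Hx). }
      rewrite lsum_const. apply Rmult_le_compat_r; [apply HF; now left|].
      apply le_INR, (HK b).
      * now apply NoDup_filter.
      * intros x Hx; now apply In_filter_decb in Hx.
      * intros x Hx; now apply In_filter_decb in Hx.
    + apply IH.
      * intros y l' N I; apply HK; trivial. intros x Hx.
        now apply I, In_filter_decb in Hx.
      * now apply NoDup_filter.
      * intros x Hx; apply In_filter_decb in Hx. destruct Hx as [Hx Hb].
        destruct (Hin x Hx); [exfalso; auto|trivial].
      * intros; apply HF; now right.
Qed.

Lemma fibre_length {A B : Type} (l : list A) (L : list B) (t : A -> B) (K : nat) :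
  (forall y l', NoDup l' -> incl l' l -> (forall x, In x l' -> t x = y) ->
     (length l' <= K)%nat) ->
  NoDup l -> (forall x, In x l -> In (t x) L) -> (length l <= K * length L)%nat.
Proof.
  intros HK Hl Hin. apply INR_le. rewrite mult_INR.
  pose proof (lsum_fibre l L t (fun _ => 1) K HK Hl Hin) as H.
  rewrite !lsum_const in H. rewrite !Rmult_1_r in H. apply H. intros; lra.
Qed.

(** * Orthogonalisation *)

(** Only positive semidefinite on functions on [V]: it sees nothing outside [l]. *)
Definition ip {V : Type} (l : list V) (u v : V -> R) : R := lsum l (fun x => u x * v x).

Definition in_span {V : Type} (n : nat) (f : nat -> V -> R) (w : V -> R) : Prop :=
  exists c : nat -> R, forall x, w x = fsum n (fun j => c j * f j x).

Lemma fsum_ext n g h : (forall i, (i < n)%nat -> g i = h i) -> fsum n g = fsum n h.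
Proof.
  induction n as [|n IH]; intro H; [easy|]. simpl. rewrite IH, H; auto.
Qed.

Lemma fsum_lsum n g : fsum n g = lsum (seq 0 n) g.
Proof.
  induction n as [|n IH]; [easy|].
  rewrite seq_S, lsum_app, <- IH, lsum_cons. simpl. ring.
Qed.

Section Orthogonal.
Context {V : Type}.
Implicit Types (l : list V) (u v w g : V -> R) (f : nat -> V -> R).

Lemma ip_sym l u v : ip l u v = ip l v u.
Proof. unfold ip; apply lsum_ext; intros; ring. Qed.

Lemma ip_ge0 l u : 0 <= ip l u u.
Proof. apply lsum_nonneg; intros; nra. Qed.

Lemma ip_ext l u u' v v' :
  (forall x, In x l -> u x = u' x) -> (forall x, In x l -> v x = v' x) ->
  ip l u v = ip l u' v'.
Proof. intros Hu Hv; apply lsum_ext; intros x Hx; now rewrite Hu, Hv. Qed.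

Lemma ip_linear l u v w c : ip l (fun x => u x + c * v x) w = ip l u w + c * ip l v w.
Proof. unfold ip; rewrite <- lsum_scal, <- lsum_plus; apply lsum_ext; intros; ring. Qed.

Lemma ip_0 l u : ip l u u = 0 -> forall x, In x l -> u x = 0.
Proof.
  intros H x Hx. pose proof (lsum_eq0 l (fun x => u x * u x)) as E.
  apply Rsqr_0_uniq. apply E; trivial. intros; nra.
Qed.

Lemma ip_fsum l n (c : nat -> R) f w :
  ip l (fun x => fsum n (fun j => c j * f j x)) w = fsum n (fun j => c j * ip l (f j) w).
Proof.
  induction n as [|n IH]; simpl.
  - apply lsum_zero; intros; ring.
  - now rewrite <- IH, ip_linear.
Qed.

Lemma ip_span0 l n f v w :
  in_span n f w -> (forall j, (j < n)%nat -> ip l v (f j) = 0) -> ip l v w = 0.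
Proof.
  intros [c Hc] H. rewrite ip_sym.
  rewrite (ip_ext l w (fun x => fsum n (fun j => c j * f j x)) v v) by auto.
  rewrite ip_fsum, fsum_lsum. apply lsum_zero; intros i Hi. apply in_seq in Hi.
  rewrite ip_sym, H; [ring|lia].
Qed.

Lemma in_span_0 n f : in_span n f (fun _ => 0).
Proof.
  exists (fun _ => 0); intros x. rewrite fsum_lsum, lsum_zero; trivial; intros; ring.
Qed.

Lemma in_span_linear n f u v a :
  in_span n f u -> in_span n f v -> in_span n f (fun x => u x + a * v x).
Proof.
  intros [c Hc] [c' Hc']. exists (fun j => c j + a * c' j); intros x.
  rewrite Hc, Hc', !fsum_lsum, <- lsum_scal, <- lsum_plus.
  apply lsum_ext; intros; ring.
Qed.

Lemma in_span_ext n f u v : (forall x, u x = v x) -> in_span n f u -> in_span n f v.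
Proof. intros E [c Hc]; exists c; intros; now rewrite <- E. Qed.

Lemma in_span_S n f u : in_span n f u -> in_span (S n) f u.
Proof.
  intros [c Hc]. exists (fun j => if Nat.eqb j n then 0 else c j); intro x.
  simpl. rewrite Nat.eqb_refl, Hc, Rmult_0_l, Rplus_0_r.
  apply fsum_ext; intros i Hi. destruct (Nat.eqb_spec i n); [lia|easy].
Qed.

Lemma in_span_gen n f : in_span (S n) f (f n).
Proof.
  exists (fun j => if Nat.eqb j n then 1 else 0); intro x. simpl.
  rewrite Nat.eqb_refl, (fsum_ext n _ (fun _ => 0)).
  - rewrite fsum_lsum, lsum_0; ring.
  - intros i Hi. destruct (Nat.eqb_spec i n); [lia|ring].
Qed.

Lemma in_span_mono n m f u : (n <= m)%nat -> in_span n f u -> in_span m f u.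
Proof. induction 1; auto using in_span_S. Qed.

(** Gram-Schmidt by induction on [n]: the residual [u] of [g] is corrected by a multiple of the
    residual [v] of [f n]. *)
Lemma projection_exists l n f g :
  exists u, in_span n f (fun x => g x - u x) /\ forall j, (j < n)%nat -> ip l u (f j) = 0.
Proof.
  revert g; induction n as [|n IH]; intro g.
  - exists g; split; [|lia]. apply in_span_ext with (fun _ => 0); [intro; ring|].
    apply in_span_0.
  - destruct (IH g) as (u & Su & Ou). destruct (IH (f n)) as (v & Sv & Ov).
    (* [f n] and [v] differ by an element of the span of the earlier [f j], hence pair equally with
       such a [w]. *)
    assert (E : forall w, (forall j, (j < n)%nat -> ip l w (f j) = 0) ->
              ip l w (f n) = ip l w v).
    { intros w Hw. pose proof (ip_span0 l n f w _ Sv Hw) as H.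
      rewrite ip_sym in H.
      rewrite (ip_ext l _ (fun x => f n x + (-1) * v x) w w) in H
        by (intros; auto; ring).
      rewrite ip_linear in H. rewrite (ip_sym l w (f n)), (ip_sym l w v). lra. }
    destruct (Req_dec (ip l v v) 0) as [Z | Z].
    (* Degenerate case: [v] vanishes on [l], so [u] is already orthogonal to [f n]. *)
    + exists u; split; [now apply in_span_S|]. intros j Hj.
      destruct (Nat.eq_dec j n) as [-> | Hn]; [|apply Ou; lia].
      rewrite E by auto. apply lsum_zero; intros x Hx.
      rewrite (ip_0 l v Z x Hx); ring.
    + set (a := - (ip l u v / ip l v v)).
      exists (fun x => u x + a * v x); split.
      * apply in_span_ext with
          (fun x => ((g x - u x) + a * (f n x - v x)) + (- a) * f n x); [intro; ring|].
        apply in_span_linear; [|apply in_span_gen].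
        apply (in_span_linear (S n) f (fun x => g x - u x) (fun x => f n x - v x));
          now apply in_span_S.
      * assert (O : forall j, (j < n)%nat -> ip l (fun x => u x + a * v x) (f j) = 0).
        { intros j Hj. rewrite ip_linear, Ou, Ov by auto. ring. }
        intros j Hj. destruct (Nat.eq_dec j n) as [-> | Hn]; [|apply O; lia].
        rewrite E by auto. rewrite ip_linear. unfold a; field; trivial.
Qed.

Definition resid_spec f l (i : nat) u : Prop :=
  in_span i f (fun x => f i x - u x) /\ forall j, (j < i)%nat -> ip l u (f j) = 0.

(** Picked by choice: the specification fixes its values on [l] only. *)
Definition resid f l (i : nat) : V -> R := epsilon (inhabits (fun _ => 0)) (resid_spec f l i).

(** The squared height of [f i] over the span of its predecessors; the product over [i < k] is the
    Gram determinant. *)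
Definition resid2 f l (i : nat) : R := ip l (resid f l i) (resid f l i).

Lemma residP f l i : resid_spec f l i (resid f l i).
Proof. unfold resid; apply epsilon_spec, projection_exists. Qed.

Lemma resid_orth_lt f l i j : (j < i)%nat -> ip l (resid f l i) (resid f l j) = 0.
Proof.
  intro Hij. destruct (residP f l i) as [_ Oi]. destruct (residP f l j) as [Sj _].
  apply (ip_span0 l i f); trivial.
  apply in_span_ext with (fun x => f j x + (-1) * (f j x - resid f l j x)); [intro; ring|].
  apply in_span_linear.
  - apply in_span_mono with (S j); [lia|apply in_span_gen].
  - apply in_span_mono with j; [lia|trivial].
Qed.

Lemma resid_orth f l i j : i <> j -> ip l (resid f l i) (resid f l j) = 0.
Proof.
  intro H. destruct (Nat.lt_total i j) as [h | [h | h]]; [|easy|].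
  - rewrite ip_sym; now apply resid_orth_lt.
  - now apply resid_orth_lt.
Qed.

(** Pythagoras: [w] minus the residual lies in the span, to which the residual is orthogonal. Thus
    residuals taken on a larger ball can compete on a smaller one. *)
Lemma resid2_min f l i w :
  in_span i f (fun x => f i x - w x) -> resid2 f l i <= ip l w w.
Proof.
  intro Sw. destruct (residP f l i) as [Si Oi]. unfold resid2. set (u := resid f l i) in *.
  assert (S : in_span i f (fun x => w x - u x)).
  { apply in_span_ext with (fun x => (f i x - u x) + (-1) * (f i x - w x)); [intro; ring|].
    now apply in_span_linear. }
  assert (Z : ip l u (fun x => w x - u x) = 0) by now apply (ip_span0 l i f).
  assert (E : ip l w w = ip l u u + 2 * ip l u (fun x => w x - u x)
             + ip l (fun x => w x - u x) (fun x => w x - u x)).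
  { unfold ip; rewrite <- lsum_scal, <- !lsum_plus; apply lsum_ext; intros; ring. }
  rewrite E, Z. pose proof (ip_ge0 l (fun x => w x - u x)). lra.
Qed.

Lemma resid2_le f l i : resid2 f l i <= ip l (f i) (f i).
Proof.
  apply resid2_min. apply in_span_ext with (fun _ => 0); [intro; ring|]. apply in_span_0.
Qed.

Definition indep_on l (k : nat) f : Prop :=
  forall c : nat -> R, (forall x, In x l -> fsum k (fun i => c i * f i x) = 0) ->
    forall i, (i < k)%nat -> c i = 0.

Lemma indep_on_incl l l' k f : incl l l' -> indep_on l k f -> indep_on l' k f.
Proof. intros I H c Hc; apply H; auto. Qed.

(** Otherwise [f i] would be, on [l], a combination of its predecessors. *)
Lemma in_span_indep l k f u i :
  indep_on l k f -> (i < k)%nat -> in_span i f (fun x => f i x - u x) ->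
  ~ (forall x, In x l -> u x = 0).
Proof.
  intros H Hi [c Hc] U.
  set (c' := fun j => if Nat.ltb j i then - c j else if Nat.eqb j i then 1 else 0).
  assert (E : forall n x, (i < n)%nat ->
    fsum n (fun j => c' j * f j x) = f i x - fsum i (fun j => c j * f j x)).
  { intros n x; induction n as [|n IHn]; [lia|]. intro Hn. simpl fsum.
    destruct (Nat.eq_dec i n) as [<- | Hne].
    - unfold c' at 2. rewrite Nat.ltb_irrefl, Nat.eqb_refl.
      rewrite (fsum_ext i _ (fun j => (-1) * (c j * f j x))).
      + rewrite !fsum_lsum, lsum_scal; ring.
      + intros j Hj. unfold c'. rewrite (proj2 (Nat.ltb_lt j i) Hj). ring.
    - rewrite IHn by lia. unfold c'.
      destruct (Nat.ltb_spec n i); [lia|]. destruct (Nat.eqb_spec n i); [lia|]. ring. }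
  assert (Z : c' i = 0).
  { apply H; trivial. intros x Hx. rewrite E by trivial.
    specialize (Hc x). specialize (U x Hx). lra. }
  unfold c' in Z. rewrite Nat.ltb_irrefl, Nat.eqb_refl in Z. lra.
Qed.

Lemma resid2_pos l k f i : indep_on l k f -> (i < k)%nat -> 0 < resid2 f l i.
Proof.
  intros H Hi. destruct (Req_dec (resid2 f l i) 0) as [Z | Z].
  - exfalso. apply (in_span_indep l k f (resid f l i) i); trivial.
    + apply residP.
    + apply ip_0, Z.
  - pose proof (ip_ge0 l (resid f l i)). unfold resid2 in *; lra.
Qed.

(** If the first [k] functions are independent on [l], the relations among all [S k] that hold on
    [l] form at most a line; one point where a spanning relation fails removes it. *)
Lemma lin_indep_indep_on k f : lin_indep k f -> exists l, indep_on l k f.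
Proof.
  induction k as [|k IH]; intro H.
  - exists []; intros c _ i Hi; lia.
  - destruct IH as [l Hl].
    { intros c Hc i Hi. set (c' := fun j => if Nat.eqb j k then 0 else c j).
      assert (Z : c' i = 0).
      { apply H; [|lia]. intro x. simpl. unfold c' at 2. rewrite Nat.eqb_refl.
        rewrite Rmult_0_l, Rplus_0_r, <- (Hc x). apply fsum_ext; intros j Hj.
        unfold c'. destruct (Nat.eqb_spec j k); [lia|easy]. }
      unfold c' in Z. destruct (Nat.eqb_spec i k); [lia|easy]. }
    destruct (classic (indep_on l (S k) f)) as [Y | N]; [now exists l|].
    apply not_all_ex_not in N as [c N]. apply imply_to_and in N as [Hc N].
    assert (Hck : c k <> 0).
    { intro Z. apply N. intros i Hi. destruct (Nat.eq_dec i k) as [-> | Hne]; trivial.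
      apply (Hl c); [|lia]. intros x Hx. specialize (Hc x Hx). simpl in Hc.
      rewrite Z in Hc. lra. }
    destruct (classic (exists x0, fsum (S k) (fun i => c i * f i x0) <> 0)) as [[x0 Hx0] | N2].
    2:{ exfalso. apply Hck, (H c); [|lia]. intro x. apply NNPP; intro Hx; apply N2; now exists x. }
    (* Any relation on [x0 :: l] is [t] times [c], and its value at [x0] forces [t = 0]. *)
    exists (x0 :: l). intros c' Hc'. set (t := c' k / c k).
    assert (P : forall i, (i < S k)%nat -> c' i = t * c i).
    { assert (Tk : c' k = t * c k) by (unfold t; field; trivial).
      intros i Hi. destruct (Nat.eq_dec i k) as [-> | Hne]; trivial.
      assert (Q : (fun j => c' j - t * c j) i = 0); [|simpl in Q; lra].
      apply (Hl (fun j => c' j - t * c j)); [|lia]. intros x Hx.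
      pose proof (Hc x Hx) as A1. pose proof (Hc' x (or_intror Hx)) as A2.
      simpl in A1, A2.
      rewrite (fsum_ext k _ (fun j => c' j * f j x - t * (c j * f j x))) by (intros; ring).
      rewrite !fsum_lsum in *. rewrite lsum_minus, lsum_scal.
      rewrite Tk in A2.
      replace (lsum (seq 0 k) (fun x1 => c' x1 * f x1 x)) with (- (t * c k * f k x)) by lra.
      replace (lsum (seq 0 k) (fun x1 => c x1 * f x1 x)) with (- (c k * f k x)) by lra.
      ring. }
    pose proof (Hc' x0 (or_introl eq_refl)) as B.
    rewrite (fsum_ext _ _ (fun i => t * (c i * f i x0))) in B
      by (intros i Hi; rewrite P by trivial; ring).
    rewrite fsum_lsum, lsum_scal, <- fsum_lsum in B.
    assert (t = 0) by (apply Rmult_integral in B; tauto).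
    intros i Hi. rewrite P by trivial. nra.
Qed.

(* Bessel's inequality for the functional [u |-> sum_h u (y h)], whose square
   norm in l^2(l) is at most [K * length L]. *)
Lemma bessel {B : Type} l (k : nat) (u : nat -> V -> R) (L : list B) (y : B -> V) (K : nat) :
  (forall i j, i <> j -> ip l (u i) (u j) = 0) ->
  (forall i, (i < k)%nat -> 0 < ip l (u i) (u i)) ->
  NoDup L -> (forall h, In h L -> In (y h) l) ->
  (forall x L', NoDup L' -> incl L' L -> (forall h, In h L' -> y h = x) ->
     (length L' <= K)%nat) ->
  lsum (seq 0 k) (fun i => lsum L (fun h => u i (y h)) ^ 2 / ip l (u i) (u i))
    <= INR K * INR (length L).
Proof.
  intros Ho Hp HL Hy HK.
  set (b := fun i => lsum L (fun h => u i (y h))).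
  set (N := fun i => ip l (u i) (u i)).
  (* [v] represents the functional on the span of the [u i]: its squared norm and the functional at
     [v] both equal [s]. *)
  set (a := fun i => b i / N i).
  set (v := fun x => fsum k (fun i => a i * u i x)).
  set (s := lsum (seq 0 k) (fun i => b i ^ 2 / N i)).
  change (s <= INR K * INR (length L)).
  assert (E1 : lsum L (fun h => v (y h)) = s).
  { unfold v, s. rewrite (lsum_ext L _ (fun h => lsum (seq 0 k) (fun i => a i * u i (y h))))
      by (intros; apply fsum_lsum).
    rewrite lsum_swap. apply lsum_ext; intros i Hi. apply in_seq in Hi.
    rewrite lsum_scal. fold (b i). unfold a. pose proof (Hp i ltac:(lia)).
    unfold N; field. lra. }
  assert (E2 : ip l v v = s).
  { unfold v at 1. rewrite ip_fsum, fsum_lsum. unfold s. apply lsum_ext; intros i Hi.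
    apply in_seq in Hi. pose proof (Hp i ltac:(lia)) as Hpi.
    rewrite ip_sym. unfold v. rewrite ip_fsum.
    assert (F : forall n, fsum n (fun j => a j * ip l (u j) (u i))
               = if Nat.ltb i n then a i * N i else 0).
    { induction n as [|n IH]; [easy|]. simpl fsum. rewrite IH.
      destruct (Nat.eq_dec i n) as [<- | Hne].
      - rewrite Nat.ltb_irrefl. rewrite (proj2 (Nat.ltb_lt i (S i))) by lia. unfold N; ring.
      - rewrite (Ho n i) by auto.
        destruct (Nat.ltb_spec i n); destruct (Nat.ltb_spec i (S n)); try lia; ring. }
    rewrite F. rewrite (proj2 (Nat.ltb_lt i k)) by lia.
    unfold a, N; field. lra. }
  (* Cauchy-Schwarz at [v], then the bound on the fibres of [y]; a positive [s] cancels. *)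
  assert (C : s ^ 2 <= INR (length L) * (INR K * s)).
  { rewrite <- E1 at 1. eapply Rle_trans; [apply lsum_sqr_le|].
    apply Rmult_le_compat_l; [apply pos_INR|].
    rewrite <- E2.
    eapply Rle_trans; [apply (lsum_fibre L l y (fun x => v x ^ 2) K); auto|].
    - intros; apply pow2_ge_0.
    - apply Rmult_le_compat_l; [apply pos_INR|]. apply Req_le.
      unfold ip; apply lsum_ext; intros; ring. }
  destruct (Rle_lt_dec s 0) as [h | h].
  - pose proof (pos_INR K). pose proof (pos_INR (length L)). nra.
  - apply Rmult_le_reg_l with s; trivial. nra.
Qed.

(** The sum over [i] and [x] of [u i x ^ 2 / |u i|^2] equals [k], while by Bessel's inequality for
    evaluation at one point each [x] contributes at most 1. *)
Lemma indep_on_length l k f : NoDup l -> indep_on l k f -> (k <= length l)%nat.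
Proof.
  intros Hl H. apply INR_le.
  set (u := resid f l).
  assert (Hp : forall i, (i < k)%nat -> 0 < ip l (u i) (u i))
    by (intros; now apply (resid2_pos l k f)).
  assert (E : lsum (seq 0 k) (fun i => lsum l (fun x => u i x ^ 2 / ip l (u i) (u i))) = INR k).
  { rewrite (lsum_ext _ _ (fun _ => 1)).
    - rewrite lsum_const, length_seq; ring.
    - intros i Hi. apply in_seq in Hi. pose proof (Hp i ltac:(lia)).
      unfold Rdiv. rewrite lsum_scal_r.
      rewrite (lsum_ext l _ (fun x => u i x * u i x)) by (intros; ring).
      fold (ip l (u i) (u i)). field. lra. }
  rewrite <- E, lsum_swap.
  apply Rle_trans with (lsum l (fun _ => 1)); [|rewrite lsum_const; lra].
  apply lsum_le; intros x Hx.
  pose proof (bessel l k u [x] (fun z => z) 1) as B.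
  simpl length in B. rewrite (lsum_ext _ _
    (fun i => lsum [x] (fun h => u i h) ^ 2 / ip l (u i) (u i))).
  - eapply Rle_trans; [apply B|simpl; lra]; auto.
    + intros; now apply resid_orth.
    + constructor; [easy|constructor].
    + intros h [<- | []]; trivial.
    + intros z L' N I _. apply (NoDup_incl_length N I).
  - intros i _. simpl. f_equal. ring.
Qed.

End Orthogonal.

(** * Balls and harmonic functions on graphs *)

Definition sym_nb {V : Type} (nb : V -> list V) : Prop :=
  forall x y, In y (nb x) -> In x (nb y).

Fixpoint reach {V : Type} (nb : V -> list V) (p : V) (n : nat) : list V :=
  match n with
  | O => [p]
  | S n => reach nb p n ++ flat_map nb (reach nb p n)
  end.

Definition ball {V : Type} (nb : V -> list V) (p : V) (n : nat) : list V :=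
  nodup (fun x y => excluded_middle_informative (x = y)) (reach nb p n).

Definition grad2 {V : Type} (nb : V -> list V) (u : V -> R) (x : V) : R :=
  lsum (nb x) (fun y => (u y - u x) ^ 2).

Lemma least_nat (P : nat -> Prop) (n : nat) :
  P n -> exists m, P m /\ forall k, P k -> (m <= k)%nat.
Proof.
  induction n as [n IH] using (well_founded_induction Wf_nat.lt_wf); intro Hn.
  destruct (classic (exists k, (k < n)%nat /\ P k)) as [(k & Hk & Pk) | H].
  - now apply (IH k).
  - exists n; split; trivial. intros k Pk.
    destruct (Nat.le_gt_cases n k); trivial. exfalso; apply H; now exists k.
Qed.

Section Walks.
Context {V : Type} (nb : V -> list V).

Lemma walk_trans x y z n m : walk nb x y n -> walk nb y z m -> walk nb x z (n + m).
Proof.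
  induction 1; intro W; [trivial|]. simpl. now apply (walkS nb x y); [|apply IHwalk].
Qed.

Lemma walk_1 x y : In y (nb x) -> walk nb x y 1.
Proof. intro H; apply (walkS nb x y y 0 H), walk0. Qed.

Lemma walk_rev x y n : sym_nb nb -> walk nb x y n -> walk nb y x n.
Proof.
  intro Hs; induction 1; [constructor|].
  rewrite <- Nat.add_1_r. apply walk_trans with y; trivial. now apply walk_1, Hs.
Qed.

Lemma walk_last x z n :
  walk nb x z (S n) -> exists y, walk nb x y n /\ In z (nb y).
Proof.
  revert x; induction n as [|n IH]; intros x W;
    inversion W as [|x' y z' n' Hy W']; subst.
  - inversion W'; subst. exists x; split; [constructor|trivial].
  - apply IH in W' as (t & Wt & I). exists t; split; trivial. now apply walkS with y.
Qed.

Lemma walk_0 x y : walk nb x y 0 -> x = y.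
Proof. now inversion 1. Qed.

Hypothesis Hs : sym_nb nb.
Hypothesis Hc : connected nb.

Lemma gdistP x y : is_dist nb x y (gdist nb x y).
Proof.
  unfold gdist; apply epsilon_spec. destruct (Hc x y) as [n Hn].
  destruct (least_nat (walk nb x y) n Hn) as (m & Wm & Hm). now exists m.
Qed.

Lemma gdist_walk x y : walk nb x y (gdist nb x y).
Proof. apply gdistP. Qed.

Lemma gdist_le x y n : walk nb x y n -> (gdist nb x y <= n)%nat.
Proof. apply gdistP. Qed.

Lemma gdist_sym x y : gdist nb x y = gdist nb y x.
Proof. apply Nat.le_antisymm; apply gdist_le, walk_rev, gdist_walk; trivial. Qed.

Lemma gdist_triangle x y z : (gdist nb x z <= gdist nb x y + gdist nb y z)%nat.
Proof. apply gdist_le, walk_trans with y; apply gdist_walk. Qed.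

Lemma gdist_refl x : gdist nb x x = 0%nat.
Proof. pose proof (gdist_le x x 0 (walk0 nb x)). lia. Qed.

Lemma gdist_nb x y : In y (nb x) -> (gdist nb x y <= 1)%nat.
Proof. intro H; apply gdist_le, walk_1, H. Qed.

Lemma reach_spec p n x : In x (reach nb p n) <-> exists m, (m <= n)%nat /\ walk nb p x m.
Proof.
  revert x; induction n as [|n IH]; intro x; simpl.
  - split.
    + intros [<- | []]. exists 0%nat; split; [lia|constructor].
    + intros (m & Hm & W). assert (m = 0)%nat by lia; subst. left; now apply walk_0.
  - rewrite in_app_iff, in_flat_map, IH. split.
    + intros [(m & Hm & W) | (y & Hy & I)].
      * exists m; split; [lia|trivial].
      * apply IH in Hy as (m & Hm & W). exists (m + 1)%nat; split; [lia|].
        apply walk_trans with y; trivial. now apply walk_1.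
    + intros (m & Hm & W). destruct m as [|m].
      * left. exists 0%nat; split; [lia|trivial].
      * right. apply walk_last in W as (y & W & I). exists y; split; trivial.
        apply IH; exists m; split; [lia|trivial].
Qed.

Lemma ball_spec p n x : In x (ball nb p n) <-> (gdist nb p x <= n)%nat.
Proof.
  unfold ball. rewrite nodup_In, reach_spec. split.
  - intros (m & Hm & W). apply gdist_le in W. lia.
  - intro H. exists (gdist nb p x); split; trivial. apply gdist_walk.
Qed.

Lemma ball_NoDup p n : NoDup (ball nb p n).
Proof. apply NoDup_nodup. Qed.

Lemma ball_incl p n m : (n <= m)%nat -> incl (ball nb p n) (ball nb p m).
Proof. intros H x. rewrite !ball_spec. lia. Qed.

Lemma ball_length Delta p n :
  (forall x, (length (nb x) <= Delta)%nat) ->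
  (length (ball nb p n) <= (Delta + 1) ^ n)%nat.
Proof.
  intro HD. apply Nat.le_trans with (length (reach nb p n)).
  - apply NoDup_incl_length; [apply ball_NoDup|].
    intros x Hx. unfold ball in Hx. now apply nodup_In in Hx.
  - induction n as [|n IH]; simpl; [lia|].
    rewrite length_app.
    assert (F : forall l, (length (flat_map nb l) <= Delta * length l)%nat).
    { induction l as [|a l IHl]; simpl; [lia|].
      rewrite length_app. specialize (HD a). lia. }
    specialize (F (reach nb p n)). nia.
Qed.

(** The bound is asked only on edges leaving points that are fewer than [n] steps away from [x], so
    a local estimate suffices. *)
Lemma walk_increment u x y n M :
  walk nb x y n ->
  (forall a b m, (m < n)%nat -> walk nb x a m -> In b (nb a) -> Rabs (u b - u a) <= M) ->
  Rabs (u y - u x) <= INR n * M.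
Proof.
  induction 1 as [x | x y z n Hy W IH]; intro H.
  - rewrite Rminus_diag, Rabs_R0. simpl; lra.
  - rewrite S_INR.
    replace (u z - u x) with ((u z - u y) + (u y - u x)) by ring.
    eapply Rle_trans; [apply Rabs_triang|].
    assert (Rabs (u z - u y) <= INR n * M).
    { apply IH. intros a b m Hm Wa Hb. apply (H a b (S m)); trivial; [lia|].
      now apply walkS with y. }
    assert (Rabs (u y - u x) <= M) by (apply (H x y 0%nat); trivial; [lia|constructor]).
    lra.
Qed.

Lemma grad2_ge0 u x : 0 <= grad2 nb u x.
Proof. apply lsum_nonneg; intros; apply pow2_ge_0. Qed.

(** A crude local Poincare inequality: the edges of a geodesic from [x] to [y] start inside the
    ball, and each increment is at most the square root of the energy there. *)
Lemma local_gradient_bound u x y K :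
  (gdist nb x y <= K)%nat ->
  (u x - u y) ^ 2 <= INR K ^ 2 * lsum (ball nb x K) (grad2 nb u).
Proof.
  intro Hd. set (E := lsum (ball nb x K) (grad2 nb u)).
  assert (HE : 0 <= E) by (apply lsum_nonneg; intros; apply grad2_ge0).
  assert (H : Rabs (u y - u x) <= INR (gdist nb x y) * sqrt E).
  { apply walk_increment with (1 := gdist_walk x y). intros a b m Hm W Hb.
    rewrite <- sqrt_Rsqr_abs. apply sqrt_le_1_alt.
    apply Rle_trans with (grad2 nb u a).
    - unfold grad2, Rsqr.
      pose proof (lsum_single_le (nb a) (fun y => (u y - u a) ^ 2) b) as Q. cbv beta in Q.
      replace ((u b - u a) * (u b - u a)) with ((u b - u a) ^ 2) by ring.
      apply Q; trivial. intros; apply pow2_ge_0.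
    - apply lsum_single_le; [intros; apply grad2_ge0|].
      apply ball_spec. apply gdist_le in W. lia. }
  assert (H2 : Rabs (u y - u x) <= INR K * sqrt E).
  { eapply Rle_trans; [exact H|]. apply Rmult_le_compat_r; [apply sqrt_pos|].
    now apply le_INR. }
  replace ((u x - u y) ^ 2) with (Rabs (u y - u x) ^ 2) by (rewrite pow2_abs; ring).
  replace E with (sqrt E ^ 2) by now apply pow2_sqrt.
  rewrite <- Rpow_mult_distr. apply pow_incr; split; [apply Rabs_pos|trivial].
Qed.

End Walks.

Lemma lsum_perm {A : Type} (l l' : list A) f : Permutation l l' -> lsum l f = lsum l' f.
Proof. induction 1; rewrite ?lsum_cons; try congruence; ring. Qed.

(** Sums over lists that vary with a parameter become weighted sums over a common list, so that the
    order of summation can be exchanged. *)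
Lemma lsum_sub {A : Type} (l L : list A) (f : A -> R) :
  NoDup l -> NoDup L -> incl l L -> lsum l f = lsum L (fun x => indic (In x l) * f x).
Proof.
  intros Hl HL I. rewrite <- lsum_filter. apply lsum_perm.
  apply NoDup_Permutation; trivial; [now apply NoDup_filter|].
  intro x. rewrite In_filter_decb. firstorder.
Qed.

(** * Green's formula, uniqueness on balls and Caccioppoli's inequality *)

Section Green.
Context {V : Type} (nb : V -> list V).
Hypothesis HX : is_graph nb.

Lemma indic_nb_sym x y : indic (In y (nb x)) = indic (In x (nb y)).
Proof.
  destruct HX as (_ & Hs & _).
  destruct (indic_cases (In y (nb x))) as [[h ->] | [h ->]].
  - now rewrite indic1 by auto.
  - rewrite indic0; auto.
Qed.

(** Summation by parts over ordered pairs: where [g x] is not 0, all neighbours of [x] lie in [L]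
    and the inner sum is the full Laplacian of [u]; symmetry of adjacency handles the half with
    [g y]. *)
Lemma green (L : list V) (g u : V -> R) :
  NoDup L -> (forall x, laplacian nb u x = 0) ->
  (forall x, In x L -> g x = 0 \/ incl (nb x) L) ->
  lsum L (fun x => lsum L (fun y =>
    indic (In y (nb x)) * ((g y - g x) * (u y - u x)))) = 0.
Proof.
  intros HL Hu Hg.
  assert (E1 : lsum L (fun x => lsum L (fun y =>
                 indic (In y (nb x)) * (g x * (u y - u x)))) = 0).
  { apply lsum_zero; intros x Hx. destruct (Hg x Hx) as [Z | I].
    - apply lsum_zero; intros; rewrite Z; ring.
    - rewrite (lsum_ext _ _ (fun y => g x * (indic (In y (nb x)) * (u y - u x))))
        by (intros; ring).
      rewrite lsum_scal, <- lsum_sub; trivial; [|apply HX].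
      change (g x * laplacian nb u x = 0). rewrite Hu; ring. }
  assert (E2 : lsum L (fun x => lsum L (fun y =>
                 indic (In y (nb x)) * (g y * (u x - u y)))) = 0).
  { rewrite lsum_swap. etransitivity; [|exact E1].
    apply lsum_ext; intros x _. apply lsum_ext; intros y _. now rewrite indic_nb_sym. }
  transitivity (-1 * (lsum L (fun x => lsum L (fun y =>
                 indic (In y (nb x)) * (g x * (u y - u x)))) +
               lsum L (fun x => lsum L (fun y =>
                 indic (In y (nb x)) * (g y * (u x - u y)))))).
  2:{ rewrite E1, E2; ring. }
  rewrite <- lsum_plus, <- lsum_scal. apply lsum_ext; intros x _.
  rewrite <- lsum_plus, <- lsum_scal. apply lsum_ext; intros y _. ring.
Qed.

Lemma lsum_indic_nb (L : list V) Delta x :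
  NoDup L -> (length (nb x) <= Delta)%nat ->
  lsum L (fun y => indic (In y (nb x))) <= INR Delta.
Proof.
  intros HL HD.
  rewrite (lsum_ext _ _ (fun y => indic (In y (nb x)) * 1)) by (intros; ring).
  rewrite <- lsum_filter, lsum_const, Rmult_1_r. apply le_INR.
  eapply Nat.le_trans; [|exact HD]. apply NoDup_incl_length.
  - now apply NoDup_filter.
  - intros y Hy. now apply In_filter_decb in Hy.
Qed.

Hypothesis Hc : connected nb.

(** Green's formula with [g = u = w] shows that the Dirichlet energy inside the ball is 0, so [w] is
    constant along geodesics from [p]. The condition at [p] also covers an empty sphere. *)
Lemma harmonic_zero_on_ball p n w :
  (forall x, laplacian nb w x = 0) ->
  (forall x, gdist nb p x = n -> w x = 0) -> w p = 0 ->
  forall x, In x (ball nb p n) -> w x = 0.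
Proof.
  intros Hw Hn Hp. destruct HX as (HN & Hs & _).
  set (L := ball nb p n).
  assert (G : lsum L (fun x => lsum L (fun y =>
            indic (In y (nb x)) * ((w y - w x) * (w y - w x)))) = 0).
  { apply green; trivial; [apply ball_NoDup|]. intros x Hx. apply ball_spec in Hx; trivial.
    destruct (Nat.eq_dec (gdist nb p x) n); [left; auto|right].
    intros y Hy. apply ball_spec; trivial.
    pose proof (gdist_triangle nb Hc p x y). pose proof (gdist_nb nb Hc x y Hy). lia. }
  assert (S : forall x y, In x L -> In y L -> In y (nb x) -> w y = w x).
  { intros x y Hx Hy I.
    assert (P : forall a b, 0 <= indic (In b (nb a)) * ((w b - w a) * (w b - w a))).
    { intros a b. apply Rmult_le_pos; [apply indic_nonneg|apply Rle_0_sqr]. }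
    pose proof (lsum_eq0 _ _ (fun a _ => lsum_nonneg L _ (fun b _ => P a b)) G x Hx) as G1.
    pose proof (lsum_eq0 _ _ (fun b _ => P x b) G1 y Hy) as G2. cbv beta in G2.
    rewrite indic1, Rmult_1_l in G2 by trivial.
    assert (w y - w x = 0) by (apply Rsqr_0_uniq; exact G2). lra. }
  assert (W : forall m x, (m <= n)%nat -> walk nb p x m -> w x = 0).
  { induction m as [|m IH]; intros x Hm Wx.
    - apply walk_0 in Wx; now subst.
    - apply walk_last in Wx as (y & Wy & I).
      rewrite (S y x); trivial; [apply IH; trivial; lia| |]; apply ball_spec; trivial.
      + apply gdist_le in Wy; trivial; lia.
      + apply gdist_le in Wy; trivial.
        pose proof (gdist_triangle nb Hc p y x). pose proof (gdist_nb nb Hc y x I). lia. }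
  intros x Hx. apply ball_spec in Hx; trivial.
  apply (W (gdist nb p x)); trivial. now apply gdist_walk.
Qed.

(** Green's formula is tested with [s^2 u], where the cut-off [s], the distance to the outer sphere,
    is 1-Lipschitz. *)
Lemma caccioppoli Delta p rho u :
  (forall x, (length (nb x) <= Delta)%nat) -> (forall x, laplacian nb u x = 0) ->
  lsum (ball nb p rho) (fun x => INR (rho - gdist nb p x) ^ 2 * grad2 nb u x)
    <= 8 * INR Delta * ip (ball nb p rho) u u.
Proof.
  intros HD Hu. destruct HX as (HN & Hs & _).
  set (L := ball nb p rho). set (s := fun x => INR (rho - gdist nb p x)).
  assert (HL : NoDup L) by apply ball_NoDup.
  (* Neighbours can leave [L] only from the sphere of radius [rho], where [s] vanishes. *)
  assert (In_L : forall x, In x L -> s x = 0 \/ incl (nb x) L).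
  { intros x Hx. unfold s. destruct (Nat.eq_dec (rho - gdist nb p x) 0) as [-> | h];
      [now left|right].
    intros y Hy. apply ball_spec; trivial.
    pose proof (gdist_triangle nb Hc p x y). pose proof (gdist_nb nb Hc x y Hy). lia. }
  assert (Lip : forall x y, In y (nb x) -> (s y - s x) ^ 2 <= 1).
  { intros x y Hy. unfold s.
    assert (H : (rho - gdist nb p y <= (rho - gdist nb p x) + 1 /\
             rho - gdist nb p x <= (rho - gdist nb p y) + 1)%nat).
    { pose proof (gdist_triangle nb Hc p x y). pose proof (gdist_nb nb Hc x y Hy).
      pose proof (gdist_triangle nb Hc p y x). pose proof (gdist_nb nb Hc y x (Hs x y Hy)).
      lia. }
    destruct H as [H1 H2]. apply le_INR in H1, H2. rewrite plus_INR in H1, H2.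
    simpl in H1, H2. nra. }
  pose proof (green L (fun x => s x ^ 2 * u x) u HL Hu) as G. cbv beta in G.
  specialize (G ltac:(intros x Hx; destruct (In_L x Hx) as [-> | I]; [left; ring|now right])).
  assert (P : lsum L (fun x => lsum L (fun y => indic (In y (nb x)) *
                (/ 4 * (s x ^ 2 * (u y - u x) ^ 2) - (u x ^ 2 + u y ^ 2)))) <= 0).
  { rewrite <- G. apply lsum_le; intros x _. apply lsum_le; intros y _.
    destruct (indic_cases (In y (nb x))) as [[h ->] | [_ ->]]; [|lra].
    rewrite !Rmult_1_l. specialize (Lip x y h).
    set (a := s x) in *. set (b := s y) in *. set (v := u x). set (w := u y).
    (* [2(b^2 w - a^2 v)(w - v) = (a^2 + b^2)(w - v)^2 + (b^2 - a^2)(w^2 - v^2)],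
       and the last product is split by AM-GM. *)
    assert (AG : 0 <= ((b + a) * (w - v) / 2 + (b - a) * (w + v)) ^ 2) by apply pow2_ge_0.
    assert (Q : (b - a) ^ 2 * (w + v) ^ 2 <= 1 * (w + v) ^ 2)
      by (apply Rmult_le_compat_r; [apply pow2_ge_0|trivial]).
    assert (Q2 : (w + v) ^ 2 <= 2 * (w ^ 2 + v ^ 2)) by (pose proof (pow2_ge_0 (w - v)); lra).
    assert (Q3 : (b + a) ^ 2 * (w - v) ^ 2 <= 2 * (b ^ 2 + a ^ 2) * (w - v) ^ 2)
      by (apply Rmult_le_compat_r; [|pose proof (pow2_ge_0 (b - a)); lra];
          apply pow2_ge_0).
    assert (Q4 : 0 <= b ^ 2 * (w - v) ^ 2)
      by (apply Rmult_le_pos; apply pow2_ge_0).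
    lra. }
  (* Each endpoint of the edges contributes at most [Delta |u|^2], so a quarter of the weighted
     gradient is at most [2 Delta |u|^2]; hence the constant 8. *)
  assert (S1 : lsum L (fun x => lsum L (fun y => indic (In y (nb x)) * u x ^ 2))
            <= INR Delta * ip L u u).
  { unfold ip. rewrite <- lsum_scal. apply lsum_le; intros x _.
    rewrite lsum_scal_r. replace (u x ^ 2) with (u x * u x) by ring.
    apply Rmult_le_compat_r; [nra|]. now apply lsum_indic_nb. }
  assert (S2 : lsum L (fun x => lsum L (fun y => indic (In y (nb x)) * u y ^ 2))
            <= INR Delta * ip L u u).
  { eapply Rle_trans; [|exact S1]. apply Req_le. rewrite lsum_swap.
    apply lsum_ext; intros x _. apply lsum_ext; intros y _. now rewrite indic_nb_sym. }
  assert (T : lsum L (fun x => s x ^ 2 * grad2 nb u x) =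
    lsum L (fun x => lsum L (fun y => indic (In y (nb x)) * (s x ^ 2 * (u y - u x) ^ 2)))).
  { apply lsum_ext; intros x Hx. destruct (In_L x Hx) as [-> | I].
    - rewrite lsum_zero; [ring|]. intros; ring.
    - unfold grad2. rewrite <- lsum_scal. now apply lsum_sub. }
  assert (E : lsum L (fun x => lsum L (fun y => indic (In y (nb x)) *
                (/ 4 * (s x ^ 2 * (u y - u x) ^ 2) - (u x ^ 2 + u y ^ 2)))) =
    / 4 * lsum L (fun x => s x ^ 2 * grad2 nb u x) -
    (lsum L (fun x => lsum L (fun y => indic (In y (nb x)) * u x ^ 2)) +
     lsum L (fun x => lsum L (fun y => indic (In y (nb x)) * u y ^ 2)))).
  { rewrite T, <- lsum_plus, <- lsum_scal, <- lsum_minus. apply lsum_ext; intros x _.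
    rewrite <- lsum_plus, <- lsum_scal, <- lsum_minus. apply lsum_ext; intros y _. ring. }
  rewrite E in P. fold L. change (fun x => INR (rho - gdist nb p x) ^ 2 * grad2 nb u x)
    with (fun x => s x ^ 2 * grad2 nb u x). lra.
Qed.

End Green.

(** * Averaging along approximate translations *)

Lemma lsum_indic_le_length {A : Type} (L l : list A) (P : A -> Prop) :
  NoDup L -> (forall x, In x L -> P x -> In x l) ->
  lsum L (fun x => indic (P x)) <= INR (length l).
Proof.
  intros HL H. rewrite (lsum_ext _ _ (fun x => indic (P x) * 1)) by (intros; ring).
  rewrite <- lsum_filter, lsum_const, Rmult_1_r. apply le_INR, NoDup_incl_length.
  - now apply NoDup_filter.
  - intros x Hx. apply In_filter_decb in Hx as [? ?]; auto.
Qed.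

Section Translations.
Context {V : Type} (nb : V -> list V).
Hypothesis HX : is_graph nb.
Hypothesis Hc : connected nb.
Context (Delta : nat).
Hypothesis HD : forall x, (length (nb x) <= Delta)%nat.
(** [theta h] stands for right translation by [h], [BG n] for the balls of the group around [e], and
    [path h] for a path from [e] that is at [h] at every time [n] with [h] in [BG n]. The two fibre
    hypotheses bound multiplicities in the point and in the group element. *)
Context {G : Type} (e : G) (theta : G -> V -> V) (BG : nat -> list G)
  (path : G -> nat -> G) (K D : nat) (C1 C2 : R).
Hypothesis HC1 : 0 < C1.
Hypothesis HC2 : 0 < C2.
Hypothesis HK : (1 <= K)%nat.
Hypothesis BG_NoDup : forall n, NoDup (BG n).
Hypothesis BG_incl : forall n m, (n <= m)%nat -> incl (BG n) (BG m).
Hypothesis BG_lower : forall n, (1 <= n)%nat -> C1 * INR n ^ D <= INR (length (BG n)).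
Hypothesis BG_upper : forall n, (1 <= n)%nat -> INR (length (BG n)) <= C2 * INR n ^ D.
Hypothesis path_0 : forall h, path h 0 = e.
Hypothesis path_end : forall h n, In h (BG n) -> path h n = h.
Hypothesis theta_e : forall x, (gdist nb (theta e x) x <= K)%nat.
Hypothesis theta_step : forall h i x,
  (gdist nb (theta (path h (S i)) x) (theta (path h i) x) <= K)%nat.
Hypothesis theta_fibre_pt : forall h y l,
  NoDup l -> (forall x, In x l -> theta h x = y) -> (length l <= K)%nat.
Hypothesis theta_fibre_gp : forall x y L,
  NoDup L -> (forall h, In h L -> theta h x = y) -> (length L <= K)%nat.

Let Hs : sym_nb nb := proj1 (proj2 HX).

Definition energy (u : V -> R) (y : V) : R := lsum (ball nb y K) (grad2 nb u).

Lemma energy_ge0 u y : 0 <= energy u y.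
Proof. apply lsum_nonneg; intros; apply grad2_ge0. Qed.

Lemma theta_dist h i x : (gdist nb x (theta (path h i) x) <= K * (i + 1))%nat.
Proof.
  induction i as [|i IH].
  - rewrite path_0, gdist_sym by trivial. pose proof (theta_e x). lia.
  - pose proof (gdist_triangle nb Hc x (theta (path h i) x) (theta (path h (S i)) x)) as H.
    rewrite (gdist_sym nb Hs Hc (theta (path h i) x)) in H.
    pose proof (theta_step h i x). nia.
Qed.

(** Telescoping along the translates of [x], Cauchy-Schwarz over the [n + 1] jumps, and the local
    gradient bound at the end point of each jump. *)
Lemma theta_variation u n h x :
  In h (BG n) ->
  (u x - u (theta h x)) ^ 2 <=
    INR (n + 1) * (INR K ^ 2 * lsum (seq 0 (n + 1)) (fun i => energy u (theta (path h i) x))).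
Proof.
  intro Hh.
  (* The index is shifted by one because [theta e] is only close to the identity: the first jump
     leads from [x] to [theta e x]. *)
  set (z := fun i => match i with O => x | S j => theta (path h j) x end).
  assert (T : forall m, lsum (seq 0 m) (fun i => u (z i) - u (z (S i))) = u (z O) - u (z m)).
  { induction m as [|m IH]; [simpl; ring|].
    rewrite seq_S, lsum_app, IH, lsum_cons. simpl. ring. }
  specialize (T (S n)). change (z O) with x in T.
  change (z (S n)) with (theta (path h n) x) in T. rewrite path_end in T by trivial.
  replace (n + 1)%nat with (S n) by lia. rewrite <- T. eapply Rle_trans; [apply lsum_sqr_le|].
  rewrite length_seq. apply Rmult_le_compat_l; [apply pos_INR|].
  rewrite <- lsum_scal. apply lsum_le; intros i _.
  replace ((u (z i) - u (z (S i))) ^ 2) with ((u (z (S i)) - u (z i)) ^ 2) by ring.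
  change (theta (path h i) x) with (z (S i)).
  apply local_gradient_bound; trivial.
  destruct i as [|i]; simpl; [rewrite path_0; apply theta_e|apply theta_step].
Qed.

Section Scale.
Context (p : V) (T rho : nat).

Definition depth (x : V) : nat := (rho - gdist nb p x)%nat.
(** The averaging radius, a small fixed proportion of the distance to the outer sphere. *)
Definition scale (x : V) : nat := (depth x / T)%nat.
Definition average (u : V -> R) (x : V) : R :=
  / INR (length (BG (scale x))) * lsum (BG (scale x)) (fun h => u (theta h x)).

Context (R0 : nat).
Hypothesis HT : (4 * K <= T)%nat.
Hypothesis HR : (R0 + T <= rho)%nat.

Lemma scale_facts x : In x (ball nb p R0) ->
  (1 <= scale x /\ scale x * T <= depth x /\ depth x < (scale x + 1) * T /\
   2 * (K * (scale x + 1)) <= depth x /\ T <= depth x)%nat.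
Proof.
  intro Hx. apply ball_spec in Hx; trivial.
  assert (Hd : (T <= depth x)%nat) by (unfold depth; lia).
  assert (T <> 0)%nat by lia.
  pose proof (Nat.Div0.mul_div_le (depth x) T) as A.
  pose proof (Nat.mul_succ_div_gt (depth x) T ltac:(lia)) as B.
  assert (1 <= scale x)%nat by (apply Nat.div_le_lower_bound; lia).
  fold (scale x) in *. repeat split; try lia; nia.
Qed.

(** The translates are within [K (scale x + 1)] of [x], which [T >= 4 K] makes at most half the
    depth of [x]; so depths along the path stay comparable. *)
Lemma theta_depth x h i : In x (ball nb p R0) -> (i <= scale x)%nat ->
  let y := theta (path h i) x in
  In y (ball nb p rho) /\ (depth x <= 2 * depth y)%nat /\ (2 * depth y <= 3 * depth x)%nat.
Proof.
  intros Hx Hi y. pose proof (scale_facts x Hx) as (A1 & A2 & A3 & A4 & A5).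
  apply ball_spec in Hx; trivial.
  pose proof (theta_dist h i x) as Hd. fold y in Hd.
  pose proof (gdist_triangle nb Hc p x y) as B1.
  pose proof (gdist_triangle nb Hc p y x) as B2.
  rewrite (gdist_sym nb Hs Hc y x) in B2.
  assert (K * (i + 1) <= K * (scale x + 1))%nat by (apply Nat.mul_le_mono_l; lia).
  rewrite ball_spec by trivial. unfold depth in *. lia.
Qed.

Lemma theta_in_ball x h : In x (ball nb p R0) -> In h (BG (scale x)) ->
  In (theta h x) (ball nb p rho).
Proof.
  intros Hx Hh. rewrite <- (path_end h (scale x) Hh).
  now apply (theta_depth x h (scale x)).
Qed.

Let BG_pos n : (1 <= n)%nat -> 0 < INR (length (BG n)).
Proof.
  intro Hn. eapply Rlt_le_trans; [|apply BG_lower, Hn].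
  apply Rmult_lt_0_compat; trivial. apply pow_lt, lt_0_INR. lia.
Qed.

(** Jensen's inequality for the uniform average over [BG (scale x)]. *)
Lemma average_variation u x : In x (ball nb p R0) ->
  (u x - average u x) ^ 2 <=
    / INR (length (BG (scale x))) * lsum (BG (scale x)) (fun h => (u x - u (theta h x)) ^ 2).
Proof.
  intro Hx. pose proof (scale_facts x Hx) as (A1 & _).
  pose proof (BG_pos _ A1) as P. unfold average. set (n := scale x) in *.
  set (N := INR (length (BG n))) in *.
  replace (u x - / N * lsum (BG n) (fun h => u (theta h x)))
    with (/ N * lsum (BG n) (fun h => u x - u (theta h x))).
  2:{ rewrite lsum_minus, lsum_const. fold N. field. lra. }
  rewrite Rpow_mult_distr.
  replace (/ N * lsum (BG n) (fun h => (u x - u (theta h x)) ^ 2))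
    with ((/ N) ^ 2 * (N * lsum (BG n) (fun h => (u x - u (theta h x)) ^ 2)))
    by (field; lra).
  apply Rmult_le_compat_l; [apply pow2_ge_0|]. apply lsum_sqr_le.
Qed.

(** [tau] is a real-valued counterpart of [scale]. For [y] on a path used for [x], [4 tau y] bounds
    the number of jumps from above and [tau y / 3] bounds [scale x] from below; so [weight] bounds
    the contribution of [y] without reference to [x]. *)
Let tau (y : V) : R := INR (depth y) / INR T.
Let weight (u : V -> R) (y : V) : R :=
  INR K ^ 2 * (4 * tau y) / (C1 * (tau y / 3) ^ D) * energy u y.
(** [wide y] bounds [scale x] for every [x] whose paths meet [y], since [depth x <= 2 depth y];
    [active] records what follows for [h] and [i] in terms of [y] alone. *)
Let wide (y : V) : nat := (2 * depth y / T)%nat.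
Let active (h : G) (i : nat) (y : V) : Prop :=
  In h (BG (wide y)) /\ (i <= wide y)%nat /\ (2 * K <= depth y)%nat /\ (1 <= wide y)%nat.

Let T_pos : 0 < INR T.
Proof. apply lt_0_INR; lia. Qed.

Let tau_pos y : (2 * K <= depth y)%nat -> 0 < tau y.
Proof.
  intro H. apply Rdiv_lt_0_compat; trivial. apply lt_0_INR. lia.
Qed.

Let weight_ge0 u y : (2 * K <= depth y)%nat -> 0 <= weight u y.
Proof.
  intro H. pose proof (tau_pos y H). apply Rmult_le_pos; [|apply energy_ge0].
  apply Rlt_le, Rdiv_lt_0_compat.
  - apply Rmult_lt_0_compat; [|lra]. apply pow_lt, lt_0_INR; lia.
  - apply Rmult_lt_0_compat; trivial. apply pow_lt. lra.
Qed.

Let wide_le y : INR (wide y) <= 2 * tau y.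
Proof.
  unfold tau. apply Rmult_le_reg_r with (INR T); trivial.
  replace (2 * (INR (depth y) / INR T) * INR T) with (INR (2 * depth y))
    by (rewrite mult_INR; simpl; field; lra).
  rewrite <- mult_INR. apply le_INR. unfold wide.
  pose proof (Nat.Div0.mul_div_le (2 * depth y) T). lia.
Qed.

(** Jensen and telescoping, with everything but the range of [h] and [i] expressed through the point
    reached. Index sets independent of [x] allow the sums to be exchanged. *)
Let average_pointwise u x : In x (ball nb p R0) ->
  (u x - average u x) ^ 2 <=
    lsum (BG rho) (fun h => lsum (seq 0 (rho + 1)) (fun i =>
      indic (In h (BG (scale x)) /\ (i <= scale x)%nat) *
      (indic (active h i (theta (path h i) x)) * weight u (theta (path h i) x)))).
Proof.
  intro Hx. pose proof (scale_facts x Hx) as (A1 & A2 & A3 & A4 & A5).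
  set (n := scale x) in *.
  assert (Hn : (n <= rho)%nat) by (unfold depth in *; nia).
  eapply Rle_trans; [apply average_variation; trivial|]. fold n.
  rewrite <- lsum_scal.
  rewrite (lsum_sub (BG n) (BG rho)); auto.
  apply lsum_le; intros h _.
  destruct (indic_cases (In h (BG n))) as [[Hh ->] | [Hh ->]].
  2:{ rewrite lsum_zero; [lra|]. intros i _. rewrite indic0 by tauto. ring. }
  rewrite Rmult_1_l.
  eapply Rle_trans.
  { apply Rmult_le_compat_l; [apply Rlt_le, Rinv_0_lt_compat; auto|].
    apply (theta_variation u n h x Hh). }
  rewrite <- !Rmult_assoc, <- lsum_scal.
  rewrite (lsum_sub (seq 0 (n + 1)) (seq 0 (rho + 1))); [|apply seq_NoDup|apply seq_NoDup|].
  2:{ intro j. rewrite !in_seq. lia. }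
  apply lsum_le; intros i _.
  destruct (indic_cases (In i (seq 0 (n + 1)))) as [[Hi ->] | [Hi ->]].
  2:{ rewrite indic0; [lra|]. intros [_ Hi']; apply Hi, in_seq. lia. }
  apply in_seq in Hi.
  rewrite indic1 by (split; [trivial|lia]).
  destruct (theta_depth x h i Hx ltac:(fold n; lia)) as (B1 & B2 & B3).
  set (y := theta (path h i) x) in *.
  assert (HN : (n <= wide y)%nat) by (apply Nat.div_le_lower_bound; nia).
  rewrite (indic1 (active h i y)).
  2:{ unfold active. split; [now apply (BG_incl n)|]. lia. }
  rewrite !Rmult_1_l. unfold weight.
  apply Rmult_le_compat_r; [apply energy_ge0|].
  assert (P : 0 < tau y) by (apply tau_pos; lia).
  (* In both comparisons [n + 1 <= 2 n] is used, as [n >= 1]. *)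
  assert (L1 : INR (n + 1) <= 4 * tau y).
  { unfold tau. apply Rmult_le_reg_r with (INR T); trivial.
    replace (4 * (INR (depth y) / INR T) * INR T) with (INR (4 * depth y))
      by (rewrite mult_INR; simpl; field; lra).
    rewrite <- mult_INR. apply le_INR. nia. }
  assert (L2 : tau y / 3 <= INR n).
  { unfold tau. apply Rmult_le_reg_r with (INR T); trivial.
    apply Rmult_le_reg_r with 3; [lra|].
    replace (INR (depth y) / INR T / 3 * INR T * 3) with (INR (depth y)) by (field; lra).
    replace 3 with (INR 3) by (simpl; lra). rewrite <- !mult_INR. apply le_INR. nia. }
  assert (L3 : C1 * (tau y / 3) ^ D <= INR (length (BG n))).
  { eapply Rle_trans; [|apply BG_lower, A1]. apply Rmult_le_compat_l; [lra|].
    apply pow_incr. lra. }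
  assert (Q : 0 < C1 * (tau y / 3) ^ D)
    by (apply Rmult_lt_0_compat; trivial; apply pow_lt; lra).
  unfold Rdiv at 1. rewrite (Rmult_comm (/ _)), Rmult_assoc, Rmult_comm, Rmult_assoc.
  assert (K2 : 0 <= INR K ^ 2) by apply pow2_ge_0.
  replace (INR K ^ 2 * (4 * tau y) * / (C1 * (tau y / 3) ^ D))
    with (/ (C1 * (tau y / 3) ^ D) * (INR K ^ 2 * (4 * tau y))) by ring.
  apply Rmult_le_compat.
  - apply Rlt_le, Rinv_0_lt_compat; auto.
  - apply Rmult_le_pos; trivial. apply pos_INR.
  - apply Rinv_le_contravar; trivial.
  - apply Rmult_le_compat_l; trivial.
Qed.

(** For fixed [h] and [i], the fibres of [theta (path h i)] have at most [K] points, so the sum over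
    [x] becomes one over [y]. At most [|BG (wide y)| (wide y + 1)] pairs are active at [y]. *)
Let pseudo_poincare_weight u :
  lsum (ball nb p R0) (fun x => (u x - average u x) ^ 2) <=
    INR K * lsum (ball nb p rho) (fun y => indic (2 * K <= depth y /\ 1 <= wide y)%nat *
      (INR (length (BG (wide y))) * INR (wide y + 1) * weight u y)).
Proof.
  eapply Rle_trans; [apply lsum_le, average_pointwise|].
  rewrite lsum_swap.
  rewrite (lsum_ext (BG rho) _ (fun h => lsum (seq 0 (rho + 1)) (fun i =>
    lsum (ball nb p R0) (fun x => indic (In h (BG (scale x)) /\ (i <= scale x)%nat) *
      (indic (active h i (theta (path h i) x)) * weight u (theta (path h i) x))))))
    by (intros; apply lsum_swap).
  apply Rle_trans with (lsum (BG rho) (fun h => lsum (seq 0 (rho + 1)) (fun i =>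
    INR K * lsum (ball nb p rho) (fun y => indic (active h i y) * weight u y)))).
  { apply lsum_le; intros h _. apply lsum_le; intros i _.
    rewrite <- lsum_filter.
    apply (lsum_fibre _ (ball nb p rho) (theta (path h i))
             (fun y => indic (active h i y) * weight u y) K).
    - intros y l' N _ F. now apply (theta_fibre_pt (path h i) y).
    - apply NoDup_filter, ball_NoDup.
    - intros x Hx. apply In_filter_decb in Hx as [Hx [_ Hi]].
      now apply theta_depth.
    - intros y _. destruct (indic_cases (active h i y)) as [[A ->] | [_ ->]]; [|lra].
      rewrite Rmult_1_l. apply weight_ge0. unfold active in A. tauto. }
  rewrite (lsum_ext (BG rho) _ (fun h => INR K * lsum (seq 0 (rho + 1)) (fun i =>
    lsum (ball nb p rho) (fun y => indic (active h i y) * weight u y))))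
    by (intros; apply lsum_scal).
  rewrite lsum_scal. apply Rmult_le_compat_l; [apply pos_INR|].
  rewrite (lsum_ext (BG rho) _ (fun h => lsum (ball nb p rho) (fun y =>
    lsum (seq 0 (rho + 1)) (fun i => indic (active h i y) * weight u y))))
    by (intros; apply lsum_swap).
  rewrite lsum_swap. apply lsum_le; intros y _.
  destruct (indic_cases (2 * K <= depth y /\ 1 <= wide y)%nat) as [[h ->] | [h ->]].
  2:{ rewrite lsum_zero; [lra|]. intros g _. apply lsum_zero; intros i _.
      rewrite indic0; [ring|]. unfold active. tauto. }
  rewrite Rmult_1_l.
  apply Rle_trans with (lsum (BG rho) (fun g => indic (In g (BG (wide y))) *
    (INR (wide y + 1) * weight u y))).
  { apply lsum_le; intros g _.
    destruct (indic_cases (In g (BG (wide y)))) as [[Hg ->] | [Hg ->]].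
    - rewrite Rmult_1_l, lsum_scal_r. apply Rmult_le_compat_r; [apply weight_ge0, h|].
      rewrite <- (length_seq (wide y + 1) 0). apply lsum_indic_le_length; [apply seq_NoDup|].
      intros i _ A. apply in_seq. unfold active in A. lia.
    - rewrite lsum_zero; [lra|]. intros i _. rewrite indic0; [ring|]. unfold active; tauto. }
  rewrite lsum_scal_r, Rmult_assoc. apply Rmult_le_compat_r.
  - apply Rmult_le_pos; [apply pos_INR|apply weight_ge0, h].
  - apply lsum_indic_le_length; auto.
Qed.

(** A vertex lies in at most [(Delta + 1)^K] balls of radius [K]. If [depth y >= 2 K], depths in the
    [K]-ball of [y] are at least half of [depth y], whence the 4. *)
Let energy_sum u :
  lsum (ball nb p rho) (fun y => indic (2 * K <= depth y)%nat *
      (INR (depth y) ^ 2 * energy u y)) <=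
    4 * INR ((Delta + 1) ^ K) *
      lsum (ball nb p rho) (fun x => INR (depth x) ^ 2 * grad2 nb u x).
Proof.
  apply Rle_trans with (lsum (ball nb p rho) (fun y => lsum (ball nb p rho) (fun x =>
    indic (In x (ball nb y K)) * (4 * (INR (depth x) ^ 2 * grad2 nb u x))))).
  { apply lsum_le; intros y Hy.
    assert (P : forall x, 0 <= 4 * (INR (depth x) ^ 2 * grad2 nb u x)).
    { intro x. pose proof (grad2_ge0 nb u x). pose proof (pow2_ge_0 (INR (depth x))). nra. }
    destruct (indic_cases (2 * K <= depth y)%nat) as [[h ->] | [h ->]].
    2:{ rewrite Rmult_0_l. apply lsum_nonneg; intros x _.
        apply Rmult_le_pos; [apply indic_nonneg|apply P]. }
    apply ball_spec in Hy; trivial.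
    rewrite Rmult_1_l. rewrite <- lsum_sub; [|apply ball_NoDup|apply ball_NoDup|].
    - unfold energy. rewrite <- lsum_scal. apply lsum_le; intros x Hx.
      apply ball_spec in Hx; trivial.
      pose proof (gdist_triangle nb Hc p y x).
      assert (L : (depth y <= 2 * depth x)%nat) by (unfold depth in *; lia).
      apply le_INR in L. rewrite mult_INR in L. simpl (INR 2) in L.
      rewrite <- Rmult_assoc. apply Rmult_le_compat_r; [apply grad2_ge0|].
      replace (4 * INR (depth x) ^ 2) with ((2 * INR (depth x)) ^ 2) by ring.
      apply pow_incr. split; [apply pos_INR|lra].
    - intros x Hx. apply ball_spec in Hx; trivial. apply ball_spec; trivial.
      pose proof (gdist_triangle nb Hc p y x). unfold depth in *; lia. }
  rewrite lsum_swap, <- lsum_scal. apply lsum_le; intros x _.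
  rewrite lsum_scal_r.
  replace (4 * INR ((Delta + 1) ^ K) * (INR (depth x) ^ 2 * grad2 nb u x))
    with (INR ((Delta + 1) ^ K) * (4 * (INR (depth x) ^ 2 * grad2 nb u x))) by ring.
  apply Rmult_le_compat_r.
  - pose proof (grad2_ge0 nb u x). pose proof (pow2_ge_0 (INR (depth x))). nra.
  - apply Rle_trans with (INR (length (ball nb x K))); [|now apply le_INR, ball_length].
    apply lsum_indic_le_length; [apply ball_NoDup|]. intros y _ H.
    apply ball_spec in H; trivial. apply ball_spec; trivial.
    now rewrite gdist_sym.
Qed.

(** The volume bounds at [2 tau y] and [tau y / 3] cancel up to [6^D C2 / C1]. What remains is
    [tau^2 = depth^2 / T^2], a gain for large [T]. *)
Lemma pseudo_poincare u :
  lsum (ball nb p R0) (fun x => (u x - average u x) ^ 2) <=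
    (64 * INR K ^ 3 * (C2 / C1) * 6 ^ D * INR ((Delta + 1) ^ K)) / INR T ^ 2 *
      lsum (ball nb p rho) (fun x => INR (depth x) ^ 2 * grad2 nb u x).
Proof.
  eapply Rle_trans; [apply pseudo_poincare_weight|].
  (* The 16 collects two factors [4 tau y], for the number of jumps and for the number of times
     [i]. *)
  set (c := 16 * INR K ^ 2 * (C2 / C1) * 6 ^ D / INR T ^ 2).
  assert (Hcp : 0 <= c).
  { unfold c. apply Rmult_le_pos; [|apply Rlt_le, Rinv_0_lt_compat, pow_lt, T_pos].
    repeat apply Rmult_le_pos; try lra; try apply pow_le; try lra; try apply pos_INR.
    apply Rlt_le, Rinv_0_lt_compat, HC1. }
  apply Rle_trans with (INR K * lsum (ball nb p rho) (fun y =>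
    c * (indic (2 * K <= depth y)%nat * (INR (depth y) ^ 2 * energy u y)))).
  - apply Rmult_le_compat_l; [apply pos_INR|]. apply lsum_le; intros y _.
    destruct (indic_cases (2 * K <= depth y /\ 1 <= wide y)%nat) as [[[h1 h2] ->] | [h ->]].
    2:{ rewrite Rmult_0_l. apply Rmult_le_pos; trivial. apply Rmult_le_pos;
          [apply indic_nonneg|]. apply Rmult_le_pos; [apply pow2_ge_0|apply energy_ge0]. }
    rewrite indic1 by trivial. rewrite !Rmult_1_l.
    pose proof (tau_pos y h1) as P. pose proof (wide_le y) as W.
    assert (W1 : INR (wide y + 1) <= 4 * tau y).
    { rewrite plus_INR. apply le_INR in h2. simpl in *. lra. }
    assert (W2 : INR (length (BG (wide y))) <= C2 * (2 * tau y) ^ D).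
    { eapply Rle_trans; [apply BG_upper, h2|]. apply Rmult_le_compat_l; [lra|].
      apply pow_incr. split; [apply pos_INR|trivial]. }
    apply Rle_trans with ((C2 * (2 * tau y) ^ D) * (4 * tau y) * weight u y).
    + apply Rmult_le_compat_r; [apply weight_ge0, h1|].
      apply Rmult_le_compat; trivial; apply pos_INR.
    + apply Req_le. unfold weight, c.
      replace (2 * tau y) with (6 * (tau y / 3)) by field. rewrite Rpow_mult_distr.
      assert (0 < (tau y / 3) ^ D) by (apply pow_lt; lra).
      replace (INR (depth y)) with (tau y * INR T) by (unfold tau; field; lra).
      field. repeat split; lra.
  - rewrite lsum_scal.
    apply Rle_trans with (INR K * (c * (4 * INR ((Delta + 1) ^ K) *
      lsum (ball nb p rho) (fun x => INR (depth x) ^ 2 * grad2 nb u x)))).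
    + apply Rmult_le_compat_l; [apply pos_INR|]. apply Rmult_le_compat_l; [exact Hcp|].
      apply energy_sum.
    + apply Req_le. unfold c. field. split; lra.
Qed.

(** By Bessel's inequality, the averages at [x] contribute at most [K / |BG (scale x)|], and
    [depth x <= 2 T scale x]. *)
Lemma average_trace k (u : nat -> V -> R) :
  (forall i j, i <> j -> ip (ball nb p rho) (u i) (u j) = 0) ->
  (forall i, (i < k)%nat -> 0 < ip (ball nb p rho) (u i) (u i)) ->
  lsum (seq 0 k) (fun i => lsum (ball nb p R0) (fun x => average (u i) x ^ 2)
      / ip (ball nb p rho) (u i) (u i)) <=
    INR K * (2 * INR T) ^ D / C1 *
      lsum (ball nb p R0) (fun x => / INR (depth x) ^ D).
Proof.
  intros Ho Hp.
  rewrite (lsum_ext _ _ (fun i => lsum (ball nb p R0) (fun x =>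
    average (u i) x ^ 2 / ip (ball nb p rho) (u i) (u i)))).
  2:{ intros; unfold Rdiv; now rewrite lsum_scal_r. }
  rewrite lsum_swap, <- lsum_scal. apply lsum_le; intros x Hx.
  pose proof (scale_facts x Hx) as (A1 & A2 & A3 & A4 & A5).
  set (n := scale x) in *. pose proof (BG_pos n A1) as PN.
  set (N := INR (length (BG n))) in *.
  pose proof (bessel (ball nb p rho) k u (BG n) (fun h => theta h x) K Ho Hp (BG_NoDup n)) as B.
  cbv beta in B. fold N in B.
  apply Rle_trans with ((/ N) ^ 2 * (INR K * N)).
  - eapply Rle_trans; [|apply Rmult_le_compat_l; [apply pow2_ge_0|apply B]].
    + rewrite <- lsum_scal. apply Req_le, lsum_ext; intros i _. unfold average.
      fold n N. rewrite Rpow_mult_distr. unfold Rdiv; ring.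
    + intros h Hh. now apply theta_in_ball.
    + intros z L' NL _ F. now apply (theta_fibre_gp x z).
  - replace ((/ N) ^ 2 * (INR K * N)) with (INR K * / N) by (field; lra).
    assert (Pd : 0 < INR (depth x)) by (apply lt_0_INR; lia).
    replace (INR K * (2 * INR T) ^ D / C1 * / INR (depth x) ^ D)
      with (INR K * / (C1 * (INR (depth x) / (2 * INR T)) ^ D)).
    2:{ unfold Rdiv at 1. rewrite Rpow_mult_distr, pow_inv.
        assert (0 < INR (depth x) ^ D) by now apply pow_lt.
        assert (0 < (2 * INR T) ^ D) by (apply pow_lt; lra). field. repeat split; lra. }
    apply Rmult_le_compat_l; [apply pos_INR|]. apply Rinv_le_contravar.
    + apply Rmult_lt_0_compat; trivial. apply pow_lt, Rdiv_lt_0_compat; lra.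
    + eapply Rle_trans; [|apply BG_lower, A1]. apply Rmult_le_compat_l; [lra|].
      apply pow_incr. split; [apply Rlt_le, Rdiv_lt_0_compat; lra|].
      apply Rmult_le_reg_r with (2 * INR T); [lra|].
      replace (INR (depth x) / (2 * INR T) * (2 * INR T)) with (INR (depth x))
        by (field; lra).
      replace 2 with (INR 2) by (simpl; lra). rewrite <- !mult_INR. apply le_INR. nia.
Qed.

End Scale.

(** Each [u i] is split into its average and an error. Combining [pseudo_poincare] with
    Caccioppoli's inequality, a large [T] makes the squared error at most [/ 16] of the squared
    norm; [h] is this [T]. *)
Lemma trace_bound : exists (c : R) (h : nat), 0 <= c /\ (1 <= h)%nat /\
  forall p R0 rho k (u : nat -> V -> R), (R0 + h <= rho)%nat ->
    (forall i, (i < k)%nat -> forall x, laplacian nb (u i) x = 0) ->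
    (forall i j, i <> j -> ip (ball nb p rho) (u i) (u j) = 0) ->
    (forall i, (i < k)%nat -> 0 < ip (ball nb p rho) (u i) (u i)) ->
    lsum (seq 0 k) (fun i => ip (ball nb p R0) (u i) (u i) / ip (ball nb p rho) (u i) (u i))
      <= c * lsum (ball nb p R0) (fun x => / INR (rho - gdist nb p x) ^ D) + INR k / 8.
Proof.
  set (c0 := 64 * INR K ^ 3 * (C2 / C1) * 6 ^ D * INR ((Delta + 1) ^ K)).
  assert (Hc0 : 0 <= c0).
  { repeat apply Rmult_le_pos; try lra; try apply pow_le; try lra; try apply pos_INR.
    apply Rlt_le, Rinv_0_lt_compat, HC1. }
  (* 128 is 8 times 16: Caccioppoli's constant and the desired smallness. As [INR T >= 1], its
     square is at least [INR T]. *)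
  destruct (INR_unbounded (128 * c0 * INR Delta)) as [T0 HT0].
  set (T := (T0 + 4 * K)%nat).
  assert (HT : (4 * K <= T)%nat) by (unfold T; lia).
  assert (PT : 1 <= INR T) by (replace 1 with (INR 1) by reflexivity; apply le_INR; lia).
  assert (QT : c0 / INR T ^ 2 * (8 * INR Delta) <= / 16).
  { apply Rmult_le_reg_r with (INR T ^ 2); [apply pow_lt; lra|].
    replace (c0 / INR T ^ 2 * (8 * INR Delta) * INR T ^ 2) with (c0 * (8 * INR Delta))
      by (field; lra).
    assert (INR T0 <= INR T) by (apply le_INR; unfold T; lia). nra. }
  exists (2 * (INR K * (2 * INR T) ^ D / C1)), T. split; [|split; [lia|]].
  { apply Rmult_le_pos; [lra|]. repeat apply Rmult_le_pos; try apply pos_INR.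
    - apply pow_le; lra.
    - apply Rlt_le, Rinv_0_lt_compat, HC1. }
  intros p R0 rho k u HR Hh Ho Hp.
  pose proof (average_trace p T rho R0 HT HR k u Ho Hp) as A.
  change (fun x => / INR (depth p rho x) ^ D)
    with (fun x => / INR (rho - gdist nb p x) ^ D) in A.
  set (av := average p T rho) in *.
  apply Rle_trans with (lsum (seq 0 k) (fun i =>
    2 * (lsum (ball nb p R0) (fun x => av (u i) x ^ 2) / ip (ball nb p rho) (u i) (u i))
      + / 8)).
  2:{ rewrite lsum_plus, lsum_scal, lsum_const, length_seq. lra. }
  apply lsum_le; intros i Hi. apply in_seq in Hi.
  pose proof (Hp i ltac:(lia)) as Pi.
  pose proof (pseudo_poincare p T rho R0 HT HR (u i)) as P.
  pose proof (caccioppoli nb HX Hc Delta p rho (u i) HD (Hh i ltac:(lia))) as Q.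
  fold c0 in P. fold av in P. set (N := ip (ball nb p rho) (u i) (u i)) in *.
  change (fun x => INR (depth p rho x) ^ 2 * grad2 nb (u i) x)
    with (fun x => INR (rho - gdist nb p x) ^ 2 * grad2 nb (u i) x) in P.
  assert (B : lsum (ball nb p R0) (fun x => (u i x - av (u i) x) ^ 2) <= / 16 * N).
  { eapply Rle_trans; [exact P|].
    eapply Rle_trans; [apply Rmult_le_compat_l; [|exact Q]|].
    - apply Rmult_le_pos; trivial. apply Rlt_le, Rinv_0_lt_compat, pow_lt; lra.
    - rewrite <- Rmult_assoc. apply Rmult_le_compat_r; lra. }
  assert (E : ip (ball nb p R0) (u i) (u i) <=
     2 * lsum (ball nb p R0) (fun x => av (u i) x ^ 2) +
     2 * lsum (ball nb p R0) (fun x => (u i x - av (u i) x) ^ 2)).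
  { unfold ip. rewrite <- !lsum_scal, <- lsum_plus. apply lsum_le; intros x _.
    (* The right side minus the left side is exactly this square. *)
    pose proof (pow2_ge_0 (u i x - 2 * av (u i) x)). nra. }
  apply Rmult_le_reg_r with N; trivial.
  rewrite Rmult_plus_distr_r. unfold Rdiv. rewrite !Rmult_assoc, Rinv_l by lra. lra.
Qed.

End Translations.

(** * The dimension count for D >= 2 *)

Lemma ln_le_minus_1 x : 0 < x -> ln x <= x - 1.
Proof.
  intro H. rewrite <- (ln_exp (x - 1)). pose proof (exp_ineq1_le (x - 1)).
  destruct (Rle_lt_or_eq_dec x (exp (x - 1))) as [h | h]; [lra| |].
  - apply Rlt_le, ln_increasing; trivial.
  - rewrite <- h. lra.
Qed.

Lemma nat_ceil r : 0 <= r -> exists n : nat, r <= INR n <= r + 1.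
Proof.
  intro H. destruct (archimed r) as [A B].
  assert (0 <= up r)%Z by (apply le_IZR; simpl; lra).
  exists (Z.to_nat (up r)). rewrite INR_IZR_INZ, Z2Nat.id by trivial. lra.
Qed.

(* The sum is dominated by the telescoping series of [1/(t + 1/2) - 1/(t + 3/2)],
   where [t = ((m + i) h - r) / h]. *)
Lemma shell_series (D m h r M : nat) : (2 <= D)%nat -> (1 <= h)%nat ->
  lsum (seq 0 M) (fun i => indic (r <= (m + i) * h)%nat *
     / INR ((m + i) * h + h - r) ^ D) <= 2 * / INR h ^ D.
Proof.
  intros HD Hh. assert (Ph : 0 < INR h) by (apply lt_0_INR; lia).
  set (t := fun i => INR ((m + i) * h - r) / INR h).
  assert (Pt : forall i, 0 <= t i).
  { intro i. apply Rmult_le_pos; [apply pos_INR|apply Rlt_le, Rinv_0_lt_compat, Ph]. }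
  (* The induction carries the telescoped value: 2 bounds [/ (t + / 2)] at the first shell reached,
     and the indicator discards the range where the subtraction in [t] is truncated. *)
  assert (Q : lsum (seq 0 M) (fun i => indic (r <= (m + i) * h)%nat *
     / INR ((m + i) * h + h - r) ^ D) <=
     indic (r <= (m + M) * h)%nat * (2 - / (t M + / 2)) * / INR h ^ D).
  { induction M as [|M IH].
    - simpl lsum. apply Rmult_le_pos; [|apply Rlt_le, Rinv_0_lt_compat, pow_lt, Ph].
      apply Rmult_le_pos; [apply indic_nonneg|].
      assert (/ (t 0%nat + / 2) <= / / 2) by (apply Rinv_le_contravar; specialize (Pt 0%nat); lra).
      rewrite Rinv_inv in H. lra.
    - rewrite seq_S, lsum_app, lsum_cons. simpl (0 + M)%nat. cbn [lsum fold_right].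
      assert (I2 : 0 <= 2 - / (t (S M) + / 2)).
      { assert (H : / (t (S M) + / 2) <= / / 2)
          by (apply Rinv_le_contravar; specialize (Pt (S M)); lra).
        rewrite Rinv_inv in H. lra. }
      assert (Ih : 0 < / INR h ^ D) by (apply Rinv_0_lt_compat, pow_lt, Ph).
      destruct (indic_cases (r <= (m + M) * h)%nat) as [[h1 E1] | [h1 E1]];
        rewrite E1 in *.
      + rewrite (indic1 (r <= (m + S M) * h)%nat) by nia.
        assert (ES : t (S M) = t M + 1).
        { unfold t. replace ((m + S M) * h - r)%nat with (((m + M) * h - r) + h)%nat by nia.
          rewrite plus_INR. field. lra. }
        assert (EM : INR ((m + M) * h + h - r) = INR h * (1 + t M)).
        { unfold t. replace ((m + M) * h + h - r)%nat with (h + ((m + M) * h - r))%nat by nia.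
          rewrite plus_INR. field. lra. }
        rewrite EM, Rpow_mult_distr, Rinv_mult. specialize (Pt M). rewrite ES.
        assert (A : / (1 + t M) ^ D <= / (t M + / 2) - / (t M + 1 + / 2)).
        { apply Rle_trans with (/ (1 + t M) ^ 2).
          - apply Rinv_le_contravar; [apply pow_lt; lra|]. apply Rle_pow; [lra|trivial].
          - replace (/ (t M + / 2) - / (t M + 1 + / 2))
              with (/ ((t M + / 2) * (t M + 1 + / 2))) by (field; lra).
            apply Rinv_le_contravar; nra. }
        nra.
      + assert (0 <= indic (r <= (m + S M) * h)%nat * (2 - / (t (S M) + / 2)) * / INR h ^ D).
        { apply Rmult_le_pos; [apply Rmult_le_pos; [apply indic_nonneg|trivial]|lra]. }
        lra. }
  eapply Rle_trans; [exact Q|].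
  apply Rmult_le_compat_r; [apply Rlt_le, Rinv_0_lt_compat, pow_lt, Ph|].
  assert (0 < / (t M + / 2)) by (apply Rinv_0_lt_compat; specialize (Pt M); lra).
  destruct (indic_cases (r <= (m + M) * h)%nat) as [[_ ->] | [_ ->]]; lra.
Qed.

Lemma laplacian_span {V : Type} (nb : V -> list V) n f w :
  (forall i, (i < n)%nat -> forall x, laplacian nb (f i) x = 0) ->
  in_span n f w -> forall x, laplacian nb w x = 0.
Proof.
  intros Hf [c Hc] x. unfold laplacian in *.
  change (lsum (nb x) (fun y => w y - w x) = 0).
  rewrite (lsum_ext _ _ (fun y => lsum (seq 0 n) (fun i => c i * (f i y - f i x)))).
  - rewrite lsum_swap. apply lsum_zero; intros i Hi. apply in_seq in Hi.
    rewrite lsum_scal. change (c i * laplacian nb (f i) x = 0).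
    unfold laplacian; rewrite Hf by lia; ring.
  - intros y _. rewrite !Hc, !fsum_lsum, <- lsum_minus.
    apply lsum_ext; intros; ring.
Qed.

Lemma laplacian_minus {V : Type} (nb : V -> list V) u v x :
  laplacian nb (fun y => u y - v y) x = laplacian nb u x - laplacian nb v x.
Proof.
  change (lsum (nb x) (fun y => (u y - v y) - (u x - v x)) =
    lsum (nb x) (fun y => u y - u x) - lsum (nb x) (fun y => v y - v x)).
  rewrite <- lsum_minus. apply lsum_ext; intros; ring.
Qed.

Lemma laplacian_resid {V : Type} (nb : V -> list V) k f l i :
  (forall i, (i < k)%nat -> forall x, laplacian nb (f i) x = 0) -> (i < k)%nat ->
  forall x, laplacian nb (resid f l i) x = 0.
Proof.
  intros Hf Hi x. destruct (residP f l i) as [S _].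
  pose proof (laplacian_span nb i f _ (fun j Hj => Hf j ltac:(lia)) S x) as H.
  rewrite laplacian_minus, Hf in H by trivial. lra.
Qed.

Lemma Hd_uniform_bound {V : Type} (nb : V -> list V) p d k (f : nat -> V -> R) :
  (forall i, (i < k)%nat -> Hd nb p d (f i)) ->
  exists C, 0 < C /\ forall i, (i < k)%nat -> forall x,
    Rabs (f i x) <= C * Rpower (INR (gdist nb x p) + 1) d.
Proof.
  induction k as [|j IH]; intro Hf.
  - exists 1; split; [lra|]. intros; lia.
  - destruct IH as (C & PC & HC); [intros; apply Hf; lia|].
    destruct (Hf j ltac:(lia)) as [_ [C' HC']].
    exists (C + Rabs C'); split; [pose proof (Rabs_pos C'); lra|].
    intros i Hi x. assert (P : 0 < Rpower (INR (gdist nb x p) + 1) d) by apply exp_pos.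
    pose proof (Rle_abs C'). pose proof (Rabs_pos C').
    destruct (Nat.eq_dec i j) as [-> | Hne].
    + specialize (HC' x). nra.
    + specialize (HC i ltac:(lia) x). nra.
Qed.

Section Count.
Context {V : Type} (nb : V -> list V).
Hypothesis HX : is_graph nb.
Hypothesis Hc : connected nb.
Context (p : V) (D h0 : nat) (c Cv : R).
Hypothesis HD : (2 <= D)%nat.
Hypothesis Hc0 : 0 <= c.
Hypothesis Hh0 : (1 <= h0)%nat.
Hypothesis Htrace : forall p R0 rho k (u : nat -> V -> R), (R0 + h0 <= rho)%nat ->
    (forall i, (i < k)%nat -> forall x, laplacian nb (u i) x = 0) ->
    (forall i j, i <> j -> ip (ball nb p rho) (u i) (u j) = 0) ->
    (forall i, (i < k)%nat -> 0 < ip (ball nb p rho) (u i) (u i)) ->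
    lsum (seq 0 k) (fun i => ip (ball nb p R0) (u i) (u i) / ip (ball nb p rho) (u i) (u i))
      <= c * lsum (ball nb p R0) (fun x => / INR (rho - gdist nb p x) ^ D) + INR k / 8.
Hypothesis HCv : 0 < Cv.
Hypothesis Hvol : forall n, (1 <= n)%nat -> INR (length (ball nb p n)) <= Cv * INR n ^ D.

Let Hs : sym_nb nb := proj1 (proj2 HX).

Context (k : nat) (f : nat -> V -> R) (d : R).
Hypothesis Hk : (1 <= k)%nat.
Hypothesis Hd1 : 1 <= d.
Hypothesis Hf : forall i, (i < k)%nat -> Hd nb p d (f i).
Context (n0 : nat).
Hypothesis Hind : indep_on (ball nb p n0) k f.

(* Logarithm of the Gram determinant of [f 0, ..., f (k-1)] in l^2(ball p n). *)
Definition log_gram (n : nat) : R := lsum (seq 0 k) (fun i => ln (resid2 f (ball nb p n) i)).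

Let Hharm i (Hi : (i < k)%nat) x : laplacian nb (f i) x = 0.
Proof. now apply Hf. Qed.

Let resid2_gt0 n i : (n0 <= n)%nat -> (i < k)%nat -> 0 < resid2 f (ball nb p n) i.
Proof.
  intros Hn Hi. apply (resid2_pos _ k); trivial.
  apply indep_on_incl with (2 := Hind). now apply ball_incl.
Qed.

(** The residuals [u i] of the larger ball, with squared norms [a] on the smaller and [b] on the
    larger ball, give growth at least [ln b - ln a >= 1 + ln 2 - 2 a / b]. Applying [ln t <= t - 1]
    to [2 a / b] rather than [a / b] makes the main term exceed [ln 2] per function. *)
Lemma log_gram_step R0 rho : (n0 <= R0)%nat -> (R0 + h0 <= rho)%nat ->
  INR k * (/ 2 + ln 2) - 2 * c * lsum (ball nb p R0) (fun x => / INR (rho - gdist nb p x) ^ D)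
    <= log_gram rho - log_gram R0.
Proof.
  intros Hn HR. set (u := resid f (ball nb p rho)).
  assert (Hp : forall i, (i < k)%nat -> 0 < ip (ball nb p rho) (u i) (u i))
    by (intros i Hi; apply (resid2_gt0 rho i); lia).
  assert (Ho : forall i j, i <> j -> ip (ball nb p rho) (u i) (u j) = 0)
    by (intros; now apply resid_orth).
  pose proof (Htrace p R0 rho k u HR
    (fun i Hi => laplacian_resid nb k f _ i Hharm Hi) Ho Hp) as T.
  unfold log_gram. rewrite <- lsum_minus.
  apply Rle_trans with (lsum (seq 0 k) (fun i => (1 + ln 2) -
    2 * (ip (ball nb p R0) (u i) (u i) / ip (ball nb p rho) (u i) (u i)))).
  { rewrite lsum_minus, lsum_scal, lsum_const, length_seq.
    pose proof (le_INR _ _ Hk). simpl in H. nra. }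
  apply lsum_le; intros i Hi. apply in_seq in Hi.
  assert (L0 : 0 < resid2 f (ball nb p R0) i) by (apply resid2_gt0; lia).
  assert (L1 : resid2 f (ball nb p R0) i <= ip (ball nb p R0) (u i) (u i))
    by (apply resid2_min, residP).
  specialize (Hp i ltac:(lia)).
  change (resid2 f (ball nb p rho) i) with (ip (ball nb p rho) (u i) (u i)).
  set (a := ip (ball nb p R0) (u i) (u i)) in *.
  set (b := ip (ball nb p rho) (u i) (u i)) in *.
  assert (L2 : ln (resid2 f (ball nb p R0) i) <= ln a).
  { destruct L1 as [L1 | ->]; [|lra]. apply Rlt_le, ln_increasing; trivial. }
  assert (Pab : 0 < a / b) by (apply Rdiv_lt_0_compat; lra).
  pose proof (ln_le_minus_1 (2 * (a / b)) ltac:(lra)) as L3.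
  rewrite ln_mult in L3 by lra. unfold Rdiv in L3 at 1.
  rewrite ln_mult in L3; [|lra|now apply Rinv_0_lt_compat].
  rewrite ln_Rinv in L3 by trivial. lra.
Qed.

(** Each squared residual is at most [|f i|^2 <= |B(p,n)| C^2 (2 n)^(2 d)]. *)
Lemma log_gram_growth : exists A, forall n, (1 <= n)%nat -> (n0 <= n)%nat ->
  log_gram n <= INR k * (A + (2 * d + INR D) * ln (INR n)).
Proof.
  destruct (Hd_uniform_bound nb p d k f Hf) as (C & PC & HC).
  exists (ln (Cv * C ^ 2) + 2 * d * ln 2). intros n Hn Hn0.
  unfold log_gram. rewrite <- (length_seq k 0) at 2. rewrite <- lsum_const.
  apply lsum_le; intros i Hi. apply in_seq in Hi.
  assert (Pn : 1 <= INR n) by (apply le_INR in Hn; exact Hn).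
  assert (P2 : 0 < C ^ 2) by now apply pow_lt.
  assert (PD : 0 < INR n ^ D) by (apply pow_lt; lra).
  set (B := Rpower (2 * INR n) (2 * d)). assert (PB : 0 < B) by apply exp_pos.
  assert (U : resid2 f (ball nb p n) i <= (Cv * INR n ^ D) * (C ^ 2 * B)).
  { eapply Rle_trans; [apply resid2_le|].
    apply Rle_trans with (INR (length (ball nb p n)) * (C ^ 2 * B)).
    2:{ apply Rmult_le_compat_r; [nra|auto]. }
    rewrite <- lsum_const. apply lsum_le; intros x Hx. apply ball_spec in Hx; trivial.
    specialize (HC i ltac:(lia) x).
    assert (Rg : Rpower (INR (gdist nb x p) + 1) d <= Rpower (2 * INR n) d).
    { apply Rle_Rpower_l; [lra|]. pose proof (pos_INR (gdist nb x p)).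
      rewrite gdist_sym in Hx by trivial. apply le_INR in Hx. lra. }
    replace B with (Rpower (2 * INR n) d ^ 2).
    2:{ unfold B. replace (2 * d) with (d + d) by ring. rewrite Rpower_plus. ring. }
    rewrite <- Rpow_mult_distr. replace (f i x * f i x) with (Rabs (f i x) ^ 2)
      by (rewrite pow2_abs; ring).
    apply pow_incr; split; [apply Rabs_pos|].
    eapply Rle_trans; [exact HC|]. apply Rmult_le_compat_l; lra. }
  assert (P0 : 0 < resid2 f (ball nb p n) i) by (apply resid2_gt0; lia).
  apply Rle_trans with (ln ((Cv * INR n ^ D) * (C ^ 2 * B))).
  { destruct U as [U | ->]; [|lra]. apply Rlt_le, ln_increasing; trivial. }
  replace ((Cv * INR n ^ D) * (C ^ 2 * B)) with ((Cv * C ^ 2) * (INR n ^ D * B)) by ring.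
  rewrite ln_mult; [|nra|nra]. rewrite (ln_mult (INR n ^ D) B) by trivial.
  rewrite (ln_pow (INR n)) by lra. unfold B, Rpower. rewrite ln_exp, (ln_mult 2) by lra. lra.
Qed.

(** Otherwise every doubling of the radius from some point on would add more than
    [k (2 d + D + 1) ln 2], beyond the rate [k (2 d + D) ln 2] of [log_gram_growth]. *)
Lemma good_scale m : (1 <= m)%nat -> forall j0, exists j, (j0 <= j)%nat /\
  log_gram (2 ^ (S j) * m) - log_gram (2 ^ j * m) <= INR k * ((2 * d + INR D + 1) * ln 2).
Proof.
  intros Hm j0. apply NNPP; intro N.
  set (g := INR k * ((2 * d + INR D + 1) * ln 2)).
  assert (N' : forall j, (j0 <= j)%nat -> log_gram (2 ^ j * m) + g < log_gram (2 ^ S j * m)).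
  { intros j Hj. destruct (Rle_lt_dec (log_gram (2 ^ S j * m) - log_gram (2 ^ j * m)) g);
      [|lra]. exfalso; apply N. now exists j. }
  (* [2 ^ j1 > j1 >= n0] puts all radii in the range of the growth bound. *)
  set (j1 := (j0 + n0)%nat).
  assert (L : forall t, log_gram (2 ^ j1 * m) + INR t * g <= log_gram (2 ^ (j1 + t) * m)).
  { induction t as [|t IH].
    - rewrite Nat.add_0_r. simpl (INR 0). lra.
    - rewrite S_INR, Nat.add_succ_r. specialize (N' (j1 + t)%nat ltac:(unfold j1; lia)). lra. }
  destruct log_gram_growth as [A HA].
  assert (P2 : forall j, (j < 2 ^ j)%nat) by (intro; apply Nat.pow_gt_lin_r; lia).
  assert (U : forall t, log_gram (2 ^ (j1 + t) * m) <=
     INR k * (A + (2 * d + INR D) * ((INR j1 + INR t) * ln 2 + ln (INR m)))).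
  { intro t. pose proof (P2 (j1 + t)%nat) as Q.
    replace ((INR j1 + INR t) * ln 2 + ln (INR m)) with (ln (INR (2 ^ (j1 + t) * m))).
    - apply HA; unfold j1 in *; nia.
    - rewrite mult_INR, ln_mult, pow_INR, ln_pow, plus_INR.
      + reflexivity.
      + simpl; lra.
      + rewrite pow_INR. apply pow_lt; simpl; lra.
      + apply lt_0_INR; lia. }
  assert (Pk : 0 < INR k) by (apply lt_0_INR; lia).
  pose proof ln_lt_2 as Pl.
  set (b := INR k * (A + (2 * d + INR D) * (INR j1 * ln 2 + ln (INR m)))
              - log_gram (2 ^ j1 * m)).
  destruct (INR_unbounded (b / (INR k * ln 2))) as [t Ht].
  specialize (L t). specialize (U t).
  assert (B : INR t * (INR k * ln 2) <= b) by (unfold b, g in *; lra).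
  assert (0 < INR k * ln 2) by (apply Rmult_lt_0_compat; lra).
  apply (Rmult_lt_compat_r (INR k * ln 2)) in Ht; trivial.
  unfold Rdiv in Ht. rewrite Rmult_assoc, Rinv_l in Ht by lra. lra.
Qed.

(** After the sums are exchanged, every vertex of the ball of radius [2 m h] contributes at most
    [2 h^(-D)] over all shells, which cancels the [h^D] of the volume. *)
Lemma shells_total m h : (1 <= m)%nat -> (1 <= h)%nat ->
  lsum (seq 0 m) (fun i => lsum (ball nb p ((m + i) * h))
    (fun x => / INR ((m + i) * h + h - gdist nb p x) ^ D)) <= 2 * Cv * 2 ^ D * INR m ^ D.
Proof.
  intros Hm Hh. set (L := ball nb p (2 * m * h)).
  assert (Ph : 0 < INR h) by (apply lt_0_INR; lia).
  apply Rle_trans with (lsum (seq 0 m) (fun i => lsum L (fun x =>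
    indic (gdist nb p x <= (m + i) * h)%nat * / INR ((m + i) * h + h - gdist nb p x) ^ D))).
  { apply lsum_le; intros i Hi. apply in_seq in Hi.
    rewrite (lsum_sub _ L); [|apply ball_NoDup|apply ball_NoDup|apply ball_incl; trivial; nia].
    apply Req_le, lsum_ext; intros x _. f_equal.
    destruct (indic_cases (gdist nb p x <= (m + i) * h)%nat) as [[h1 ->] | [h1 ->]].
    - apply indic1. now apply ball_spec.
    - apply indic0. intro H. now apply ball_spec in H. }
  rewrite lsum_swap.
  apply Rle_trans with (lsum L (fun _ => 2 * / INR h ^ D)).
  { apply lsum_le; intros x _. now apply shell_series. }
  rewrite lsum_const.
  apply Rle_trans with (Cv * INR (2 * m * h) ^ D * (2 * / INR h ^ D)).
  - apply Rmult_le_compat_r.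
    + apply Rmult_le_pos; [lra|]. apply Rlt_le, Rinv_0_lt_compat, pow_lt, Ph.
    + apply Hvol. nia.
  - apply Req_le. rewrite !mult_INR, !Rpow_mult_distr. simpl (INR 2).
    replace (1 + 1) with 2 by ring.
    assert (0 < INR h ^ D) by now apply pow_lt. field. lra.
Qed.

(** Adding the steps over the [m] shells gives [m k (1/2 + ln 2) - 2 c w <= m k ln 2], hence
    [m k <= 4 c w], where [w = O(m^D)]. *)
Lemma dimension_bound :
  INR k <= 8 * c * Cv * 2 ^ D * INR (D + 4) ^ (D - 1) * d ^ (D - 1).
Proof.
  (* With at least [2 d + D + 1] shells, the growth at a good scale is at most [ln 2] per function
     and shell; [d >= 1] bounds their number by [(D + 4) d]. *)
  destruct (nat_ceil (2 * d + INR D + 1)) as [m [Hm1 Hm2]];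
    [pose proof (pos_INR D); lra|].
  assert (Pm1 : 1 <= INR m) by (pose proof (pos_INR D); lra).
  assert (Hm : (1 <= m)%nat) by (apply INR_le; exact Pm1).
  assert (Hm3 : INR m <= INR (D + 4) * d).
  { rewrite plus_INR. simpl (INR 4). pose proof (pos_INR D). nra. }
  (* Since [2 ^ j > j >= n0 + h0], the shell width exceeds [h0] and all radii exceed [n0]. *)
  destruct (good_scale m Hm (n0 + h0)) as (j & Hj & HG).
  set (h := (2 ^ j)%nat) in *.
  assert (Hjh : (j < h)%nat) by (apply Nat.pow_gt_lin_r; lia).
  assert (L : forall M, INR M * (INR k * (/ 2 + ln 2)) - 2 * c *
    lsum (seq 0 M) (fun i => lsum (ball nb p ((m + i) * h))
    (fun x => / INR ((m + i) * h + h - gdist nb p x) ^ D))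
    <= log_gram ((m + M) * h) - log_gram (m * h)).
  { induction M as [|M IH].
    - rewrite Nat.add_0_r. simpl. lra.
    - rewrite seq_S, lsum_app, lsum_cons, S_INR. simpl (0 + M)%nat. cbn [lsum fold_right].
      pose proof (log_gram_step ((m + M) * h) ((m + M) * h + h) ltac:(nia) ltac:(lia)) as Q.
      replace ((m + S M) * h)%nat with ((m + M) * h + h)%nat by nia. lra. }
  specialize (L m).
  replace ((m + m) * h)%nat with (2 ^ S j * m)%nat in L by (unfold h; simpl; nia).
  rewrite (Nat.mul_comm m h) in L.
  pose proof (shells_total m h Hm ltac:(lia)) as W.
  set (w := lsum (seq 0 m) _) in *.
  assert (Pk : 0 < INR k) by (apply lt_0_INR; lia).
  pose proof ln_lt_2 as Pl.
  assert (HG2 : INR k * ((2 * d + INR D + 1) * ln 2) <= INR m * (INR k * ln 2)).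
  { replace (INR m * (INR k * ln 2)) with (INR k * (INR m * ln 2)) by ring.
    apply Rmult_le_compat_l; [lra|]. apply Rmult_le_compat_r; lra. }
  assert (X : INR m * INR k <= 4 * c * w) by lra.
  assert (X2 : 4 * c * w <= 4 * c * (2 * Cv * 2 ^ D * INR m ^ D))
    by (apply Rmult_le_compat_l; lra).
  assert (X3 : INR k <= 8 * c * Cv * 2 ^ D * INR m ^ (D - 1)).
  { apply Rmult_le_reg_l with (INR m); [lra|].
    replace (INR m ^ D) with (INR m * INR m ^ (D - 1)) in X2.
    - lra.
    - replace D with (S (D - 1)) at 2 by lia. reflexivity. }
  eapply Rle_trans; [exact X3|]. rewrite !Rmult_assoc.
  repeat (apply Rmult_le_compat_l; [try apply pow_le; lra|]).
  rewrite <- Rpow_mult_distr. apply pow_incr; split; [lra|trivial].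
Qed.

End Count.

Lemma list_in_ball {V : Type} (nb : V -> list V) p (l : list V) :
  sym_nb nb -> connected nb -> exists n, incl l (ball nb p n).
Proof.
  intros Hs Hc; induction l as [|a l [n IH]].
  - exists 0%nat; intros x [].
  - exists (n + gdist nb p a)%nat. intros x [<- | Hx].
    + apply ball_spec; trivial; lia.
    + apply (ball_incl nb Hc p n); [lia|auto].
Qed.

(** * Growth of degree at most one *)

Section LinearGrowth.
Context {V : Type} (nb : V -> list V).
Hypothesis HX : is_graph nb.
Hypothesis Hc : connected nb.
Context (p : V) (Cv : R).
Hypothesis Hvol : forall n, (1 <= n)%nat -> INR (length (ball nb p n)) <= Cv * INR n.

Let Hs : sym_nb nb := proj1 (proj2 HX).

Definition sphere (n : nat) : list V :=
  filter (fun x => decb (gdist nb p x = n)) (ball nb p n).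

Lemma sphere_spec n x : In x (sphere n) <-> gdist nb p x = n.
Proof. unfold sphere. rewrite In_filter_decb, ball_spec by trivial. lia. Qed.

Lemma ball_sphere n :
  (length (ball nb p n) + length (sphere (S n)) <= length (ball nb p (S n)))%nat.
Proof.
  rewrite <- length_app. apply NoDup_incl_length.
  - apply NoDup_app; [apply ball_NoDup|apply NoDup_filter, ball_NoDup|].
    intros x Hx Hx'. apply ball_spec in Hx; trivial. apply sphere_spec in Hx'. lia.
  - intros x Hx. apply in_app_iff in Hx as [Hx | Hx].
    + now apply (ball_incl nb Hc p n); [lia|].
    + apply sphere_spec in Hx. apply ball_spec; trivial; lia.
Qed.

(** Otherwise the ball of radius [2 N] would have at least [1 + 2 Cv N] points, the 1 counting [p],
    against the volume bound [2 Cv N]. *)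
Lemma small_sphere N : (1 <= N)%nat ->
  exists n, (N <= n)%nat /\ INR (length (sphere n)) <= 2 * Cv.
Proof.
  intro HN. apply NNPP; intro H.
  assert (H' : forall n, (N <= n)%nat -> 2 * Cv < INR (length (sphere n))).
  { intros n Hn. destruct (Rle_lt_dec (INR (length (sphere n))) (2 * Cv)); trivial.
    exfalso; apply H; now exists n. }
  assert (L : forall t, 1 + INR t * (2 * Cv) <= INR (length (ball nb p (N + t)))).
  { induction t as [|t IH].
    - simpl (INR 0). rewrite Rmult_0_l, Rplus_0_r. apply (le_INR 1).
      assert (I : In p (ball nb p (N + 0))).
      { apply ball_spec; trivial. rewrite gdist_refl; trivial; lia. }
      destruct (ball nb p (N + 0)); [easy|simpl; lia].
    - pose proof (ball_sphere (N + t)) as B. apply le_INR in B. rewrite plus_INR in B.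
      specialize (H' (S (N + t)) ltac:(lia)). rewrite Nat.add_succ_r, S_INR. lra. }
  specialize (L N). specialize (Hvol (N + N)%nat ltac:(lia)).
  rewrite plus_INR in Hvol. lra.
Qed.

(** A combination vanishing at [p] and on a far sphere vanishes inside, where independence is
    already visible; so the functions are independent on at most [2 Cv + 1] points. *)
Lemma linear_growth_dimension k f :
  (forall i, (i < k)%nat -> forall x, laplacian nb (f i) x = 0) -> lin_indep k f ->
  INR k <= 2 * Cv + 1.
Proof.
  intros Hf Hli. destruct (lin_indep_indep_on k f Hli) as [l0 Hl0].
  destruct (list_in_ball nb p l0 Hs Hc) as [n0 Hn0].
  destruct (small_sphere (S n0) ltac:(lia)) as (n & Hn & Hsph).
  set (l := nodup (fun x y => excluded_middle_informative (x = y)) (p :: sphere n)).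
  assert (Hl : forall x, In x (p :: sphere n) -> In x l) by (intros; now apply nodup_In).
  assert (Hk : (k <= length l)%nat).
  { apply (indep_on_length l k f); [apply NoDup_nodup|].
    intros c Hcf. apply Hl0. intros x Hx.
    apply (harmonic_zero_on_ball nb HX Hc p n (fun x => fsum k (fun i => c i * f i x))).
    - apply (laplacian_span nb k f); trivial. now exists c.
    - intros y Hy. apply Hcf, Hl. right. now apply sphere_spec.
    - apply Hcf, Hl. now left.
    - apply (ball_incl nb Hc p n0); [lia|auto]. }
  assert (Hlen : (length l <= S (length (sphere n)))%nat).
  { change (S (length (sphere n))) with (length (p :: sphere n)).
    apply NoDup_incl_length; [apply NoDup_nodup|]. intros x Hx. now apply nodup_In in Hx. }
  apply le_INR in Hk. apply le_INR in Hlen. rewrite S_INR in Hlen. lra.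
Qed.

End LinearGrowth.

(** * Cayley graphs and rough isometries *)

(** The path rests at its end point, so that one path serves every radius; hence the alternative
    [q (S i) = q i]. *)
Lemma walk_path {V : Type} (nb : V -> list V) x y n : walk nb x y n ->
  exists q : nat -> V, q 0%nat = x /\
    (forall i, q (S i) = q i \/ In (q (S i)) (nb (q i))) /\
    forall m, (n <= m)%nat -> q m = y.
Proof.
  induction 1 as [x | x y z n Hy W (q & Q0 & Q1 & Q2)].
  - exists (fun _ => x); auto.
  - exists (fun i => match i with O => x | S j => q j end). split; [easy|split].
    + intros [|i]; [right; now rewrite Q0|apply Q1].
    + intros [|m] Hm; [lia|]. apply Q2. lia.
Qed.

Lemma choice_fun {A B : Type} (P : A -> B -> Prop) :
  (forall x, exists y, P x y) -> exists g, forall x, P x (g x).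
Proof.
  intro H. exists (fun x => proj1_sig (constructive_indefinite_description _ (H x))).
  intro x. apply proj2_sig.
Qed.

Section Cayley.
Context {G : Type} (mul : G -> G -> G) (inv : G -> G) (e : G) (S : list G).
Hypothesis HG : is_group mul inv e.
Hypothesis HS : fin_sym_gen_set mul inv e S.

Lemma mul_cancel_l g x y : mul g x = mul g y -> x = y.
Proof.
  destruct HG as (As & El & _ & Il & _). intro H.
  rewrite <- (El x), <- (El y), <- (Il g), <- !As. now rewrite H.
Qed.

Lemma mul_cancel_r g x y : mul x g = mul y g -> x = y.
Proof.
  destruct HG as (As & _ & Er & _ & Ir). intro H.
  rewrite <- (Er x), <- (Er y), <- (Ir g), !As. now rewrite H.
Qed.

Lemma cayley_sym : sym_nb (cayley_nb mul S).
Proof.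
  destruct HG as (As & _ & Er & _ & Ir). destruct HS as (_ & _ & Sy & _).
  intros x y H. apply in_map_iff in H as (s & <- & Hsn).
  apply in_map_iff. exists (inv s). split; [|auto]. now rewrite <- As, Ir, Er.
Qed.

(** Generators act on the right, so left multiplications are automorphisms of the Cayley graph. *)
Lemma cayley_shift g x y :
  In y (cayley_nb mul S x) -> In (mul g y) (cayley_nb mul S (mul g x)).
Proof.
  destruct HG as (As & _). intro H. apply in_map_iff in H as (s & <- & Hsn).
  apply in_map_iff. exists s. now rewrite As.
Qed.

Lemma cayley_walk_shift g x y n :
  walk (cayley_nb mul S) x y n -> walk (cayley_nb mul S) (mul g x) (mul g y) n.
Proof.
  induction 1; [constructor|]. apply walkS with (mul g y); trivial. now apply cayley_shift.
Qed.

Lemma cayley_connected : connected (cayley_nb mul S).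
Proof.
  destruct HG as (As & El & Er & Il & Ir). destruct HS as (_ & _ & _ & Ge).
  (* A word is read as a walk: its first letter is an edge from [e], and the walk of the rest is
     translated by that letter on the left. *)
  assert (W : forall l, Forall (fun s => In s S) l ->
    exists n, walk (cayley_nb mul S) e (fold_right mul e l) n).
  { induction 1 as [|s l Hsn Hl [n IH]].
    - exists 0%nat; constructor.
    - exists (Datatypes.S n). apply walkS with (mul s e).
      + apply in_map_iff. exists s. now rewrite El, Er.
      + now apply cayley_walk_shift. }
  intros x y. destruct (Ge (mul (inv x) y)) as (l & Hl & E).
  destruct (W l Hl) as [n Wn]. exists n. apply (cayley_walk_shift x) in Wn.
  rewrite <- E, Er, As, Ir, El in Wn. exact Wn.
Qed.

Lemma cayley_gdist_shift g x y :
  gdist (cayley_nb mul S) (mul g x) (mul g y) = gdist (cayley_nb mul S) x y.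
Proof.
  assert (L : forall h a b,
    (gdist (cayley_nb mul S) (mul h a) (mul h b) <= gdist (cayley_nb mul S) a b)%nat).
  { intros h a b. apply gdist_le; [apply cayley_connected|].
    apply cayley_walk_shift, gdist_walk, cayley_connected. }
  apply Nat.le_antisymm; [apply L|].
  destruct HG as (As & El & _ & Il & _).
  pose proof (L (inv g) (mul g x) (mul g y)) as H. now rewrite !As, Il, !El in H.
Qed.

End Cayley.

Section RoughIsometry.
Context {V : Type} (nb : V -> list V).
Hypothesis HX : is_graph nb.
Hypothesis Hc : connected nb.
Context (Delta : nat).
Hypothesis HDelta : forall x, (length (nb x) <= Delta)%nat.
Context {G : Type} (mul : G -> G -> G) (inv : G -> G) (e : G) (S : list G).
Hypothesis HG : is_group mul inv e.
Hypothesis HS : fin_sym_gen_set mul inv e S.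
Context (D : nat) (C1 C2 : R).
Hypothesis HC1 : 0 < C1.
Hypothesis HC2 : 0 < C2.
Hypothesis Hgrowth : forall n k : nat, (1 <= n)%nat ->
  ball_card (cayley_nb mul S) e n k -> C1 * INR n ^ D <= INR k <= C2 * INR n ^ D.

Notation nbG := (cayley_nb mul S).
Let Hs : sym_nb nb := proj1 (proj2 HX).
Let HsG : sym_nb nbG := cayley_sym mul inv e S HG HS.
Let HcG : connected nbG := cayley_connected mul inv e S HG HS.

Lemma cayley_ball_growth n : (1 <= n)%nat ->
  C1 * INR n ^ D <= INR (length (ball nbG e n)) <= C2 * INR n ^ D.
Proof.
  intro Hn. apply Hgrowth; trivial. exists (ball nbG e n).
  split; [apply ball_NoDup|split; trivial]. intro x. now apply ball_spec.
Qed.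

Lemma cayley_ball_length g n : (length (ball nbG g n) <= (length S + 1) ^ n)%nat.
Proof. apply ball_length. intro x. unfold cayley_nb. now rewrite length_map. Qed.

Context (phi : V -> G) (psi : G -> V) (A : nat).
Hypothesis HA : (1 <= A)%nat.
Hypothesis phi_upper : forall x y, (gdist nbG (phi x) (phi y) <= A * gdist nb x y + A)%nat.
Hypothesis phi_lower : forall x y, (gdist nb x y <= A * gdist nbG (phi x) (phi y) + A)%nat.
Hypothesis phi_psi : forall g, (gdist nbG g (phi (psi g)) <= A)%nat.

Let NG := ((length S + 1) ^ (2 * A))%nat.
Let NX := ((Delta + 1) ^ A)%nat.
(** A sum, so as to dominate at once the displacement [A (2 A + 1) + A] of [psi] over neighbours and
    the fibre bound [NX NG]. *)
Let K := (2 * A * A + 2 * A + NX * NG + 1)%nat.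
(** Right multiplication by [h] moves every point of [G] by the length of [h]; [phi] and [psi]
    transport it to [X]. *)
Let theta (h : G) (x : V) : V := psi (mul (phi x) h).

Let NX_pos : (1 <= NX)%nat.
Proof. unfold NX. pose proof (Nat.pow_nonzero (Delta + 1) A). lia. Qed.

Let psi_close g g' : psi g = psi g' -> (gdist nbG g g' <= 2 * A)%nat.
Proof.
  intro E. pose proof (gdist_triangle nbG HcG g (phi (psi g)) g') as T.
  pose proof (phi_psi g). pose proof (phi_psi g') as P. rewrite <- E in P.
  rewrite gdist_sym in P by trivial. lia.
Qed.

Let phi_fibre y l : NoDup l -> (forall x, In x l -> phi x = y) -> (length l <= NX)%nat.
Proof.
  intros N F. destruct l as [|x0 l]; [simpl; lia|].
  apply Nat.le_trans with (length (ball nb x0 A)); [|now apply ball_length].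
  apply NoDup_incl_length; trivial. intros x Hx. apply ball_spec; trivial.
  pose proof (phi_lower x0 x) as L. rewrite (F x Hx), (F x0 (or_introl eq_refl)) in L.
  rewrite gdist_refl in L by trivial. lia.
Qed.

(** Equal values of [psi] put the products [phi x h] into one ball of radius [2 A]; right
    cancellation and the fibres of [phi] bound the multiplicity. *)
Let theta_fibre_pt h y l :
  NoDup l -> (forall x, In x l -> theta h x = y) -> (length l <= K)%nat.
Proof.
  intros N F. destruct l as [|x0 l]; [simpl; lia|]. set (l1 := x0 :: l) in *.
  pose proof (cayley_ball_length (mul (phi x0) h) (2 * A)) as B. fold NG in B.
  assert (Q : (length l1 <= NX * length (ball nbG (mul (phi x0) h) (2 * A)))%nat).
  { apply (fibre_length l1 _ (fun x => mul (phi x) h)); trivial.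
    - intros g l' N' _ F'. destruct l' as [|x1 l']; [simpl; lia|].
      apply (phi_fibre (phi x1)); trivial. intros x Hx.
      apply (mul_cancel_r mul inv e HG h). rewrite (F' x Hx). symmetry. apply F'. now left.
    - intros x Hx. apply ball_spec; trivial. apply psi_close.
      fold (theta h x0) (theta h x). rewrite (F x Hx). apply F. now left. }
  unfold K. nia.
Qed.

Let theta_fibre_gp x y L :
  NoDup L -> (forall h, In h L -> theta h x = y) -> (length L <= K)%nat.
Proof.
  intros N F. destruct L as [|h0 L]; [simpl; lia|]. set (L1 := h0 :: L) in *.
  pose proof (cayley_ball_length (mul (phi x) h0) (2 * A)) as B. fold NG in B.
  (* Left cancellation makes [h |-> phi x h] injective, hence the factor 1. *)
  assert (Q : (length L1 <= 1 * length (ball nbG (mul (phi x) h0) (2 * A)))%nat).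
  { apply (fibre_length L1 _ (fun h => mul (phi x) h)); trivial.
    - intros g l' N' _ F'. destruct l' as [|h1 [|h2 l']]; simpl; try lia.
      exfalso. inversion N' as [|? ? N1 _]; subst. apply N1. left.
      apply (mul_cancel_l mul inv e HG (phi x)). rewrite !F'; simpl; auto.
    - intros h Hh. apply ball_spec; trivial. apply psi_close.
      fold (theta h0 x) (theta h x). rewrite (F h Hh). apply F. now left. }
  unfold K. nia.
Qed.

Let theta_e x : (gdist nb (theta e x) x <= K)%nat.
Proof.
  unfold theta. pose proof HG as (_ & _ & Er & _). rewrite Er.
  pose proof (phi_lower (psi (phi x)) x) as L. pose proof (phi_psi (phi x)) as P.
  rewrite gdist_sym in P by trivial. unfold K. nia.
Qed.

Let psi_nb g g' : (gdist nbG g g' <= 1)%nat -> (gdist nb (psi g') (psi g) <= K)%nat.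
Proof.
  intro H. pose proof (phi_lower (psi g') (psi g)) as L.
  pose proof (gdist_triangle nbG HcG (phi (psi g')) g' (phi (psi g))) as T1.
  pose proof (gdist_triangle nbG HcG g' g (phi (psi g))) as T2.
  pose proof (phi_psi g). pose proof (phi_psi g') as P.
  rewrite gdist_sym in P, H by trivial.
  unfold K. nia.
Qed.

Lemma rough_isometry_trace_bound : exists (c : R) (h : nat), 0 <= c /\ (1 <= h)%nat /\
  forall p R0 rho k (u : nat -> V -> R), (R0 + h <= rho)%nat ->
    (forall i, (i < k)%nat -> forall x, laplacian nb (u i) x = 0) ->
    (forall i j, i <> j -> ip (ball nb p rho) (u i) (u j) = 0) ->
    (forall i, (i < k)%nat -> 0 < ip (ball nb p rho) (u i) (u i)) ->
    lsum (seq 0 k) (fun i => ip (ball nb p R0) (u i) (u i) / ip (ball nb p rho) (u i) (u i))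
      <= c * lsum (ball nb p R0) (fun x => / INR (rho - gdist nb p x) ^ D) + INR k / 8.
Proof.
  destruct (choice_fun (fun (h : G) (q : nat -> G) => q 0%nat = e /\
    (forall i, q (Datatypes.S i) = q i \/ In (q (Datatypes.S i)) (nbG (q i))) /\
    forall m, (gdist nbG e h <= m)%nat -> q m = h)) as [path Hpath].
  { intro h. apply walk_path, gdist_walk, HcG. }
  apply (trace_bound nb HX Hc Delta HDelta e theta (ball nbG e) path K D C1 C2);
    trivial.
  - unfold K; lia.
  - intro; apply ball_NoDup.
  - intros; now apply ball_incl.
  - intros; now apply cayley_ball_growth.
  - intros; now apply cayley_ball_growth.
  - intro h; apply Hpath.
  - intros h n Hn. apply Hpath. now apply ball_spec in Hn.
  (* By left invariance, multiplying consecutive path points by [phi x] keeps them at distance at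
     most 1. *)
  - intros h i x. apply psi_nb. rewrite (cayley_gdist_shift mul inv e S HG HS).
    destruct (Hpath h) as (_ & H & _). destruct (H i) as [-> | I].
    + rewrite gdist_refl by trivial. lia.
    + now apply gdist_nb.
Qed.

(** Left translation by the inverse of [phi p] sends the image of the ball into the ball of radius
    [A n + A <= 2 A n] around [e], with fibres of at most [NX] points. *)
Lemma rough_isometry_growth p : exists Cv, 0 < Cv /\
  forall n, (1 <= n)%nat -> INR (length (ball nb p n)) <= Cv * INR n ^ D.
Proof.
  assert (PA : 0 < INR A) by (apply lt_0_INR; lia).
  exists (INR NX * (C2 * (2 * INR A) ^ D)). split.
  { apply Rmult_lt_0_compat; [apply lt_0_INR; lia|].
    apply Rmult_lt_0_compat; trivial. apply pow_lt; lra. }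
  intros n Hn.
  assert (Q : (length (ball nb p n) <= NX * length (ball nbG e (2 * A * n)))%nat).
  { apply (fibre_length _ _ (fun x => mul (inv (phi p)) (phi x))).
    - intros g l' N _ F. destruct l' as [|x1 l']; [simpl; lia|].
      apply (phi_fibre (phi x1)); trivial. intros x Hx.
      apply (mul_cancel_l mul inv e HG (inv (phi p))). rewrite (F x Hx).
      symmetry. apply F. now left.
    - apply ball_NoDup.
    - intros x Hx. apply ball_spec in Hx; trivial. apply ball_spec; trivial.
      pose proof (phi_upper p x) as U.
      rewrite <- (cayley_gdist_shift mul inv e S HG HS (inv (phi p))) in U.
      pose proof HG as (_ & _ & _ & Il & _). rewrite Il in U. nia. }
  apply le_INR in Q. rewrite mult_INR in Q.
  eapply Rle_trans; [exact Q|]. rewrite Rmult_assoc. apply Rmult_le_compat_l; [apply pos_INR|].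
  eapply Rle_trans; [apply cayley_ball_growth; nia|]. apply Req_le.
  rewrite !mult_INR, !Rpow_mult_distr. simpl (INR 2).
  replace (1 + 1) with 2 by ring. ring.
Qed.

End RoughIsometry.

(** * Assembling the two ranges of the homogeneous dimension *)

Theorem theorem1p2
  (V : Type) (nbX : V -> list V)
  (HX : is_graph nbX) (HXc : connected nbX) (HXb : bounded_geometry nbX)
  (G : Type) (mul : G -> G -> G) (inv : G -> G) (e : G) (HG : is_group mul inv e)
  (S : list G) (HS : fin_sym_gen_set mul inv e S)
  (D : nat) (HD : homogeneous_dim mul e S D)
  (Hiso : roughly_isometric nbX (cayley_nb mul S))
  (p : V) :
  exists C : R, forall d : R, 1 <= d ->
    dim_le (Hd nbX p d) (C * d ^ (D - 1)).
Proof.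
  destruct HXb as [Delta HDelta]. destruct HD as (C1 & C2 & HC1 & HC2 & Hgr).
  destruct Hiso as (phi & a & b & Ha & Hb & Hphi & Hsur).
  destruct (choice_fun _ Hsur) as [psi Hpsi].
  (* One integer absorbs [a], [b] and the product [a b], which appears when the lower bound is
     solved for the distance in [X]. *)
  destruct (nat_ceil (a + b + a * b)) as [A [HA _]]; [nra|].
  assert (Ea : a <= INR A) by nra. assert (Eb : b <= INR A) by nra.
  assert (Eab : a * b <= INR A) by nra.
  assert (HA1 : (1 <= A)%nat) by (apply INR_le; simpl; lra).
  assert (Up : forall x y, (gdist (cayley_nb mul S) (phi x) (phi y)
                            <= A * gdist nbX x y + A)%nat).
  { intros x y. apply INR_le. rewrite plus_INR, mult_INR. destruct (Hphi x y) as [_ H].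
    pose proof (pos_INR (gdist nbX x y)). nra. }
  assert (Lo : forall x y, (gdist nbX x y
                  <= A * gdist (cayley_nb mul S) (phi x) (phi y) + A)%nat).
  { intros x y. apply INR_le. rewrite plus_INR, mult_INR. destruct (Hphi x y) as [H _].
    pose proof (pos_INR (gdist (cayley_nb mul S) (phi x) (phi y))).
    assert (H2 : a * (/ a * INR (gdist nbX x y) - b)
                 <= a * INR (gdist (cayley_nb mul S) (phi x) (phi y)))
      by (apply Rmult_le_compat_l; lra).
    rewrite Rmult_minus_distr_l, <- Rmult_assoc, Rinv_r, Rmult_1_l in H2 by lra. nra. }
  assert (Ps : forall g, (gdist (cayley_nb mul S) g (phi (psi g)) <= A)%nat).
  { intro g. apply INR_le. specialize (Hpsi g). lra. }
  destruct (rough_isometry_growth nbX HXc Delta HDelta mul inv e S HG HS D C1 C2 HC2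
              Hgr phi A HA1 Up Lo p) as (Cv & HCv & Hvol).
  destruct (le_lt_dec D 1) as [HD1 | HD2].
  (* The truncated exponent [D - 1] is 0 for [D = 0] as well, and [n^D <= n] gives linear volume
     growth. *)
  - exists (2 * Cv + 1). intros d Hd1 k f Hf Hli.
    replace (D - 1)%nat with 0%nat by lia. rewrite Rmult_1_r.
    apply (linear_growth_dimension nbX HX HXc p Cv) with f; trivial.
    + intros n Hn. eapply Rle_trans; [apply Hvol, Hn|]. apply Rmult_le_compat_l; [lra|].
      apply (le_INR 1) in Hn. rewrite <- (pow_1 (INR n)) at 2. now apply Rle_pow.
    + intros i Hi. now apply Hf.
  - destruct (rough_isometry_trace_bound nbX HX HXc Delta HDelta mul inv e S HG HS D C1 C2
                HC1 HC2 Hgr phi psi A HA1 Lo Ps) as (c & h0 & Hc & Hh0 & Htr).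
    exists (8 * c * Cv * 2 ^ D * INR (D + 4) ^ (D - 1)). intros d Hd1 k f Hf Hli.
    destruct (lin_indep_indep_on k f Hli) as [l Hl].
    destruct (list_in_ball nbX p l (proj1 (proj2 HX)) HXc) as [n0 Hn0].
    destruct (Nat.eq_dec k 0) as [-> | Hk].
    + repeat apply Rmult_le_pos; try apply pow_le; try apply pos_INR; lra.
    + apply (dimension_bound nbX HX HXc p D h0 c Cv ltac:(lia) Hc Hh0 Htr HCv Hvol k f d
               ltac:(lia) Hd1 Hf n0).
      now apply indep_on_incl with (1 := Hn0).
Qed.
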